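(* Let $m,n\ge 1$. Fix $mn$ complex numbers $\{a_j^{(i)}\}_{1\le i\le n,\,1\le j\le m}$ such that no two of them differ by an integer, an integer $M>0$, and any nondegenerate $A_0\in\operatorname{Mat}(m,\mathbb{C})$. Then for generic $C_1,\dots,C_n\in\operatorname{Mat}(m,\mathbb{C})$ with $Sp(C_i)=\{a_j^{(i)}\}_{j=1}^m$, there exists a unique family $$\{C_i(l_1,\dots,l_n):\ i=1,\dots,n,\ (l_1,\dots,l_n)\in\mathbb{Z}^n,\ \max_{s}|l_s|\le M\}$$ which satisfies, for every $i=1,\dots,n$, the following identity of polynomials in $z$: $$(z+1-C_i)\cdots(z+1-C_n)\,A_0\,(z-C_1)\cdots(z-C_{i-1})=(z+1-\widetilde C_{i+1})\cdots(z+1-\widetilde C_n)\,A_0\,(z-\widetilde C_1)\cdots(z-\widetilde C_i),\qquad(\mathrm{i})$$ where $C_j=C_j(l_1,\dots,l_n)$ and $\widetilde C_j=C_j(l_1,\dots,l_{i-1},l_i+1,l_{i+1},\dots,l_n)$ for all $j$; and, consequently, also satisfies $$C_i(l_1+1,\dots,l_n+1)=A_0^{-1}C_i(l_1,\dots,l_n)A_0-I,\qquad i=1,\dots,n;\qquad(\mathrm{ii})$$ and such that $$Sp(C_i(l_1,\dots,l_n))=Sp(C_i)-l_i\quad\text{and}\quad C_i(0,\dots,0)=C_i\qquad\text{for all }i=1,\dots,n.$$ The matrix elements of $C_i(l)$ are rational functions of the matrix elements of the initial conditions $\{C_i\}_{i=1}^n$, and these rational functions do not depend on the eigenvalues $\{a_j^{(i)}\}$.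 Moreover, the matrices $$B_i(k_1,\dots,k_n):=C_i(k_1,\dots,k_i,k_{i+1}-1,\dots,k_n-1),\qquad i=1,\dots,n,$$ solve the difference Schlesinger equations $$B_i(\dots)-B_i(\dots,k_j+1,\dots)=B_j(\dots)-B_j(\dots,k_i+1,\dots),$$ $$B_j(\dots,k_i+1,\dots)\,B_i(\dots)=B_i(\dots,k_j+1,\dots)\,B_j(\dots),$$ $$B_i(k_1+1,\dots,k_n+1)=A_0^{-1}B_i(k_1,\dots,k_n)A_0-I,\qquad i,j=1,\dots,n.$$
   Context: $\operatorname{Mat}(m,\mathbb{C})$ is the algebra of $m\times m$ complex matrices; scalars such as $z$ stand for scalar matrices; $Sp(C)$ denotes the spectrum of $C$, and $Sp(C_i)-l_i$ is the set of eigenvalues each shifted by $-l_i$. ''Generic'' means: belonging to a (nonempty) Zariski open subset of the algebraic variety of all $n$-tuples $(C_1,\dots,C_n)$ with the prescribed spectra. In (i), for $i=1$ the product $(z-C_1)\cdots(z-C_{i-1})$ is empty, and for $i=n$ the product $(z+1-\widetilde C_{i+1})\cdots(z+1-\widetilde C_n)$ is empty. In the difference Schlesinger equations dots in the arguments mean that the other $k_s$'s remain unchanged, i.e. with $e_i$ the standard basis of $\mathbb{Z}^n$: $B_i(k)-B_i(k+e_j)=B_j(k)-B_j(k+e_i)$ and $B_j(k+e_i)B_i(k)=B_i(k+e_j)B_j(k)$. All equations are understood for those multi-indices for which every matrix involved is defined (lies in the range $\max_s|l_s|\le M$). *)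

(* Defs.v *)
From mathcomp Require Import all_boot all_order all_algebra.
From mathcomp Require Import boolp classical_sets reals.
From mathcomp.real_closed Require Import complex.
From mathcomp Require Import mpoly.

Set Implicit Arguments.
Unset Strict Implicit.
Unset Printing Implicit Defensive.

Import Order.TTheory GRing.Theory Num.Theory.
Local Open Scope ring_scope.
Local Open Scope classical_set_scope.

Section Tuples.
Variables (K : fieldType) (n m : nat).

Definition Sp (A : 'M[K]_m) : set K := [set x | eigenvalue A x].

Definition mtuple := 'I_n -> 'M[K]_m.

Definition prescribed (a : 'I_n -> 'I_m -> K) : set mtuple :=
  [set C | forall i, Sp (C i) = range (a i)].

(* One variable for each matrix entry: (i, p, q) stands for the entry (p, q)
   of the i-th matrix. *)
Definition epoly := {mpoly K[#|{: 'I_n * 'I_m * 'I_m}|]}.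

Definition epoly_eval (P : epoly) (C : mtuple) : K :=
  P.@[fun t => let: (i, p, q) := enum_val t in C i p q].

Definition ratfun := {fraction epoly}.

(* [f] is regular at [C], with value [v] there. *)
Definition ratfun_value (f : ratfun) (C : mtuple) (v : K) : Prop :=
  exists P Q : epoly, [/\ f = tofrac P / tofrac Q, epoly_eval Q C != 0
                        & v = epoly_eval P C / epoly_eval Q C].

(* [U] is the complement in [V] of the common zero locus of the polynomials
   in [S]. *)
Definition zariski_open_in (V U : set mtuple) : Prop :=
  exists S : set epoly,
    U = V `&` [set C | exists2 P, S P & epoly_eval P C != 0].

Definition generic (V P : set mtuple) : Prop :=
  exists U, [/\ zariski_open_in V U, U !=set0 & U `<=` P].

End Tuples.

Definition no_integer_difference (K : fieldType) (n m : nat)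
    (a : 'I_n -> 'I_m -> K) : Prop :=
  forall (i i' : 'I_n) (j j' : 'I_m), (i, j) != (i', j') ->
  forall z : int, a i j - a i' j' != z%:~R.

Section Families.
Variables (K : fieldType) (n m M : nat) (A0 : 'M[K]_m) (C : mtuple K n m).

Local Notation mindex := 'rV[int]_n.

Definition in_box (l : mindex) : Prop := forall s, (`|l 0%R s| <= M)%N.

Definition ebasis (i : 'I_n) : mindex := delta_mx 0 i.

Definition ones : mindex := const_mx 1.

(* Values outside the box are irrelevant: every condition below, and the
   uniqueness claim, only concerns indices in the box. *)
Definition mfamily := 'I_n -> mindex -> 'M[K]_m.

(* [z + c - A], as a matrix with polynomial entries in z *)
Definition linfac (c : K) (A : 'M[K]_m) : 'M[{poly K}]_m :=
  ('X + c%:P)%:M - map_mx polyC A.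

(* The products of matrices are taken in increasing order of the index. *)
Definition refactorization (D : mfamily) : Prop :=
  forall (i : 'I_n) (l : mindex), in_box l -> in_box (l + ebasis i) ->
  \prod_(j < n | (i <= j)%N) linfac 1 (D j l)
    *m map_mx polyC A0
    *m \prod_(j < n | (j < i)%N) linfac 0 (D j l)
  = \prod_(j < n | (i < j)%N) linfac 1 (D j (l + ebasis i))
    *m map_mx polyC A0
    *m \prod_(j < n | (j <= i)%N) linfac 0 (D j (l + ebasis i)).

Definition shifted_spectra (D : mfamily) : Prop :=
  forall (i : 'I_n) (l : mindex), in_box l ->
  Sp (D i l) = [set x - (l 0 i)%:~R | x in Sp (C i)].

Definition initial_condition (D : mfamily) : Prop :=
  forall i : 'I_n, D i 0 = C i.

Definition is_solution (D : mfamily) : Prop :=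
  [/\ refactorization D, shifted_spectra D & initial_condition D].

Definition quasiperiodic (D : mfamily) : Prop :=
  forall (i : 'I_n) (l : mindex), in_box l -> in_box (l + ones) ->
  D i (l + ones) = invmx A0 *m D i l *m A0 - 1%:M.

(* (k_1, ..., k_i, k_{i+1} - 1, ..., k_n - 1) *)
Definition lower_after (i : 'I_n) (k : mindex) : mindex :=
  \row_s (k 0 s - (i < s)%N%:R).

Definition Bmx (D : mfamily) (i : 'I_n) (k : mindex) : 'M[K]_m :=
  D i (lower_after i k).

Definition B_defined (i : 'I_n) (k : mindex) : Prop :=
  in_box (lower_after i k).

Definition difference_schlesinger (D : mfamily) : Prop :=
  let B := Bmx D in
  (forall (i j : 'I_n) (k : mindex),
     B_defined i k -> B_defined i (k + ebasis j) ->
     B_defined j k -> B_defined j (k + ebasis i) ->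
     B i k - B i (k + ebasis j) = B j k - B j (k + ebasis i)
     /\ B j (k + ebasis i) *m B i k = B i (k + ebasis j) *m B j k)
  /\ (forall (i : 'I_n) (k : mindex),
        B_defined i k -> B_defined i (k + ones) ->
        B i (k + ones) = invmx A0 *m B i k *m A0 - 1%:M).

End Families.

(* Main.v *)
Require Import Defs.
From mathcomp Require Import all_boot all_order all_algebra.
From mathcomp Require Import zify ring spectral mpoly.
From mathcomp Require Import boolp classical_sets reals.
From mathcomp.real_closed Require Import complex.

(** Read the linear factors [z + 1 - C_1], ..., [z + 1 - C_n] as one period of a
    bi-infinite product, each period arising from the one on its right by
    [X |-> A0^-1 X A0 - 1].  Raising [l_i] by one carries the [i]-th factor of
    every period to the right past the [n - 1] factors that separate it from
    its next place, and (i) says that the product does not change.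

    Two neighbouring factors are exchanged as follows.  If [X] and [Y] have
    disjoint spectra, the Sylvester equation [T X - Y T = 1] has one solution
    [T]; if [T] is invertible and [S = T^-1], then
    [(z - X)(z - Y) = (z - (X - S))(z - (Y + S))], where [X - S = S Y T] and
    [Y + S = T X S] have the spectra of [Y] and of [X] (swapP).  Since [X - S]
    and [Y + S] are obtained by solving linear equations, they are rational in
    the entries of [X] and [Y], by a formula that ignores the eigenvalues.

    That the result does not depend on the order of the exchanges comes from
    uniqueness: if [P R = P' R'] with [det R] prime to [det P'], then [R] is a
    right divisor of [R'] (coprime_right_divisor).  Hence a monic right divisor
    is determined by the set of zeros of its determinant.  Keep [2 N] periods
    of the product, with [N = M + 3], and call the factors in them particles.
    For a vector of heights [k], sort to the right the particles lying in the
    lowest [N + k_i] periods for each type [i], and let [R_k] be the product of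
    those sorted to the right.  As particles have disjoint spectra,
    [R_(k + e_i) = (z - B_i(k)) R_k] (right_factors_step), and comparing
    subleading coefficients gives [B_i(k) = s(k + e_i) - s(k)] where [s(k)] is
    the sum of the matrices in the factors of [R_k].  All the equations follow:
    - going from [k] to [k + e_i + e_j] in two ways gives the difference
      Schlesinger equations;
    - shifting the window by one period gives the quasi-periodicity of the
      [B_i] (right_factors_quasi, rsum_step_quasi);
    - put [C_i(l) = B_i(l_1, ..., l_i, l_(i+1) + 1, ..., l_n + 1)]; then, up to
      a factor [A0] and the translation of [z] by one, the two sides of (i) are
      the quotient [R_(k + 1) R_k^-1] for the same [k], computed along two
      lattice paths (right_factors_telescope, evolution_refactorization).

    A solution is unique because a product of linear factors with coprime
    characteristic polynomials determines its factors (linprod_inj); in (i)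
    this fixes [C(l + e_i)] from [C(l)] and conversely.

    For rationality, run the same construction over the field of rational
    functions, at the matrices of independent variables.  The rational
    functions regular at [C] form a local ring, and evaluation at [C] is
    compatible with every step as long as the finitely many determinants that
    are inverted are units there (sift_value).  This condition on [C] is open.
    To see that it is satisfied somewhere on the variety, triangularize [A0] and
    take all [C_i] diagonal in the same basis: exchanging triangular matrices
    with disjoint diagonals never fails (trig_in_swap), because [T] is then
    triangular with diagonal entries [1 / (x_p - y_p)]. *)

Set Implicit Arguments.
Unset Strict Implicit.
Unset Printing Implicit Defensive.
Import Order.TTheory GRing.Theory Num.Theory.
Local Open Scope ring_scope.

(** * Products of monic linear factors *)

Section LinearFactors.
Variables (K : fieldType) (m' : nat).
Local Notation m := m'.+1.
Implicit Types (A B X Y : 'M[K]_m) (s r : seq 'M[K]_m).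
Implicit Types (P Q U : 'M[{poly K}]_m).

Definition linprod s : 'M[{poly K}]_m := \prod_(A <- s) char_poly_mx A.

Lemma linprod_cons A s : linprod (A :: s) = char_poly_mx A * linprod s.
Proof. by rewrite /linprod big_cons. Qed.

Lemma linprod_cat s r : linprod (s ++ r) = linprod s * linprod r.
Proof. by rewrite /linprod big_cat. Qed.

Lemma det_linprod s : \det (linprod s) = \prod_(A <- s) char_poly A.
Proof.
elim: s => [|A s IHs]; first by rewrite /linprod !big_nil det1.
by rewrite linprod_cons -mulmxE det_mulmx IHs big_cons.
Qed.

Lemma det_linprod_monic s : \det (linprod s) \is monic.
Proof. by rewrite det_linprod monic_prod // => A _; apply: char_poly_monic. Qed.

Lemma linprod_rcancel s : injective (fun P => P * linprod s).
Proof.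
move=> P Q /(congr1 (mulmxr (\adj (linprod s)))) /=.
rewrite -!mulmxE -!mulmxA mul_mx_adj !mul_mx_scalar => /matrixP eqPQ.
apply/matrixP=> i j; have:= eqPQ i j; rewrite !mxE.
by apply/mulfI/monic_neq0/det_linprod_monic.
Qed.

(** Degrees and leading coefficients of matrix polynomials are best read in the
    ring of polynomials with matrix coefficients, where products of ['X - A]
    are monic. *)
Lemma linprod_to_poly : exists phi : {rmorphism 'M[{poly K}]_m -> {poly 'M[K]_m}},
  injective phi /\ forall s, phi (linprod s) = \prod_(A <- s) ('X - A%:P).
Proof.
have [phi [/bij_inj phi_inj phiZ phiC _]] := mx_poly_ring_isom K m'.
exists phi; split=> // s; rewrite rmorph_prod; apply: eq_bigr => A _.
by rewrite rmorphB /= phiZ phiC map_polyX.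
Qed.

Lemma subleading_prod_XsubM A s :
  (\prod_(B <- A :: s) ('X - B%:P) : {poly 'M[K]_m})`_(size s)
  = - \sum_(B <- A :: s) B.
Proof.
elim: s A => [|B s IHs] A.
  by rewrite !big_seq1 coefB coefX coefC sub0r.
rewrite big_cons mulrBl coefB coefXM coefCM /= IHs.
have -> : (\prod_(j <- B :: s) ('X - j%:P) : {poly 'M[K]_m})`_(size s).+1 = 1.
  have /monicP := monic_prod_XsubC (B :: s) xpredT id.
  by rewrite /lead_coef size_prod_XsubC.
by rewrite mulr1 [in RHS]big_cons opprD addrC.
Qed.

Lemma prod_XsubM_quotient s r (u : {poly 'M[K]_m}) :
  \prod_(A <- r) ('X - A%:P) = u * \prod_(A <- s) ('X - A%:P) ->
  lead_coef u = 1 /\ size u + size s = (size r).+1.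
Proof.
have mon (t : seq 'M[K]_m) : \prod_(A <- t) ('X - A%:P) \is monic.
  exact: monic_prod_XsubC.
move=> equ; have u0 : u != 0.
  by apply: contraNneq (monic_neq0 (mon r)) => u0; rewrite equ u0 mul0r.
split; first by rewrite -(lead_coef_Mmonic _ (mon s)) -equ; apply/monicP.
have := congr1 (fun p : {poly 'M[K]_m} => size p) equ.
by rewrite size_Mmonic // !size_prod_XsubC addnS => ->.
Qed.

Lemma linprod_quotient_id s r U :
  linprod r = U * linprod s -> size r = size s -> U = 1.
Proof.
have [phi [phi_inj phiE]] := linprod_to_poly.
move=> /(congr1 phi); rewrite rmorphM !phiE => /prod_XsubM_quotient[lcu szu].
move=> sz_rs; apply: phi_inj; rewrite rmorph1.
have sz1 : size (phi U) = 1%N by lia.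
by rewrite (size1_polyC (eq_leq sz1)) -polyC1 -lcu lead_coefE sz1.
Qed.

(** The coefficient just below the top one of [linprod s] is minus the sum of
    [s]; this makes [B_i(k)] a difference of two sums of matrices. *)
Lemma linprod_quotient_linear s r U :
  linprod r = U * linprod s -> size r = (size s).+1 ->
  U = char_poly_mx (\sum_(A <- r) A - \sum_(A <- s) A).
Proof.
have [phi [phi_inj phiE]] := linprod_to_poly.
move=> /(congr1 phi); rewrite rmorphM !phiE => equ.
have [lcu szu] := prod_XsubM_quotient equ => sz_rs.
apply: phi_inj; have := phiE [:: \sum_(A <- r) A - \sum_(A <- s) A].
rewrite /linprod !big_seq1 => ->.
have sz2 : size (phi U) = 2%N by lia.
have [c phiU] : exists c, phi U = 'X - c%:P.
  exists (- (phi U)`_0); rewrite polyCN opprK; apply/polyP=> -[|[|k]].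
  - by rewrite coefD coefX coefC add0r.
  - by rewrite coefD coefX coefC addr0 -lcu lead_coefE sz2.
  - by rewrite coefD coefX coefC addr0 nth_default // sz2.
rewrite phiU; congr (_ - _%:P).
clear szu; case: r equ sz_rs => [//|B r] equ [szr].
have := subleading_prod_XsubM B r.
rewrite equ phiU mulrBl coefB coefXM coefCM szr.
case: s equ szr => [|A s] equ szr /=.
  rewrite !big_nil coefC /= sub0r mulr1 subr0 => /eqP.
  by rewrite eqr_opp => /eqP.
have -> : (\prod_(j <- A :: s) ('X - j%:P) : {poly 'M[K]_m})`_(size s).+1 = 1.
  have /monicP := monic_prod_XsubC (A :: s) xpredT id.
  by rewrite /lead_coef size_prod_XsubC.
rewrite subleading_prod_XsubM mulr1 => /eqP.
rewrite -opprD eqr_opp => /eqP <-.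
by rewrite addrAC subrr add0r.
Qed.

(** The matrix rational function [R' R^-1 = P'^-1 P] has a denominator dividing
    [\det R] and one dividing [\det P'], so by coprimality it is polynomial. *)
Lemma coprime_right_divisor (P P' R R' : 'M[{poly K}]_m) :
  P * R = P' * R' -> \det R != 0 -> coprimep (\det R) (\det P') ->
  exists U, R' = U * R.
Proof.
move=> eqPR R0 co.
have eq1 : \det P' *: (R' * \adj R) = \det R *: (\adj P' * P).
  rewrite -!mulmxE scalemxAl -(mul_scalar_mx (\det P')) -mul_adj_mx.
  rewrite -(mulmxA (\adj P')) !mulmxE -eqPR -!mulmxE -!mulmxA mul_mx_adj.
  by rewrite !mul_mx_scalar scalemxAr.
have dvd i j : \det R %| (R' * \adj R) i j.
  rewrite -(Gauss_dvdpr _ co).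
  have /matrixP/(_ i j) := eq1; rewrite !mxE => ->.
  by rewrite dvdp_mulr.
pose U : 'M[{poly K}]_m := \matrix_(i, j) ((R' * \adj R) i j %/ \det R).
have UE : R' * \adj R = \det R *: U.
  by apply/matrixP=> i j; rewrite [in RHS]mxE [U i j]mxE mulrC divpK.
exists U; have : \det R *: R' = \det R *: (U * R).
  rewrite -!mulmxE scalemxAl -UE -mulmxE -mulmxA mul_adj_mx.
  by rewrite mul_mx_scalar.
move=> /matrixP eq2; apply/matrixP=> i j.
by have := eq2 i j; rewrite !mxE; apply: mulfI.
Qed.

Lemma right_divisor_unique (P P' : 'M[{poly K}]_m) r r' :
  P * linprod r = P' * linprod r' -> size r = size r' ->
  coprimep (\det (linprod r)) (\det P') -> linprod r = linprod r'.
Proof.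
move=> eqP szr co; have R0 := monic_neq0 (det_linprod_monic r).
have [U eqU] := coprime_right_divisor eqP R0 co.
by rewrite eqU (linprod_quotient_id eqU) ?mul1r.
Qed.

Lemma right_divisor_step (P P' : 'M[{poly K}]_m) r r' :
  P * linprod r = P' * linprod r' -> size r' = (size r).+1 ->
  coprimep (\det (linprod r)) (\det P') ->
  linprod r' = char_poly_mx (\sum_(A <- r') A - \sum_(A <- r) A) * linprod r.
Proof.
move=> eqP szr co; have R0 := monic_neq0 (det_linprod_monic r).
have [U eqU] := coprime_right_divisor eqP R0 co.
by rewrite -(linprod_quotient_linear eqU).
Qed.

Lemma char_poly_mx_inj : injective (@char_poly_mx K m).
Proof.
move=> A B /addrI/oppr_inj/matrixP eqAB; apply/matrixP=> i j.
by have := eqAB i j; rewrite !mxE => /polyC_inj.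
Qed.

(** By coprimality the product of all factors but the first one is determined
    as a right divisor; cancelling it determines the first factor. *)
Lemma linprod_inj s s' :
  pairwise (@coprimep K) [seq char_poly A | A <- s] ->
  [seq char_poly A | A <- s] = [seq char_poly A | A <- s'] ->
  linprod s = linprod s' -> s = s'.
Proof.
elim: s s' => [|A s IHs] [|A' s'] //= /andP[coA cos] [eqA eqs].
rewrite !linprod_cons => eqP.
have eqss' : linprod s = linprod s'.
  apply: (right_divisor_unique eqP).
    by rewrite -(size_map (@char_poly _ _)) eqs size_map.
  rewrite det_linprod -/(char_poly _) -eqA coprimep_sym.
  rewrite -(big_map (@char_poly _ _) xpredT id).
  by elim: (map _ _) coA => [|p ps IHp] /=; rewrite ?big_nil ?coprimep1 //
    big_cons coprimepMr => /andP[-> /IHp].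
rewrite (IHs _ cos eqs eqss'); congr (_ :: _); apply: char_poly_mx_inj.
by move: eqP; rewrite eqss' => /linprod_rcancel.
Qed.

End LinearFactors.

(** * Exchanging and sorting linear factors *)

Section Swap.
Variables (L : fieldType) (m : nat).
Implicit Types (S T X Y : 'M[L]_m) (s : seq 'M[L]_m) (bs : seq (bool * 'M[L]_m)).

(** The matrix, acting on vectorized [T], of the linear map
    [T |-> T X - Y T]. *)
Definition sylvester X Y : 'M[L]_(m * m) :=
  lin_mx (mulmxr X) - lin_mx (mulmx Y).

Definition sylvester_sol X Y : 'M[L]_m :=
  vec_mx (mxvec 1%:M *m invmx (sylvester X Y)).

Definition swap X Y : 'M[L]_m * 'M[L]_m :=
  let S := invmx (sylvester_sol X Y) in (X - S, Y + S).

(** The exchange of [X] and [Y] is possible when neither entry vanishes. *)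
Definition swap_dets X Y : seq L :=
  [:: \det (sylvester X Y); \det (sylvester_sol X Y)].

Fixpoint carry X s : seq 'M[L]_m * 'M[L]_m :=
  if s is Y :: s' then
    let r := carry (swap X Y).2 s' in ((swap X Y).1 :: r.1, r.2)
  else ([::], X).

Fixpoint carry_dets X s : seq L :=
  if s is Y :: s' then swap_dets X Y ++ carry_dets (swap X Y).2 s' else [::].

(** A factor labelled [true] is carried to the right past all the factors
    labelled [false] that come after it, so the first component collects the
    factors labelled [false] and the second one those labelled [true]. *)
Fixpoint sift bs : seq 'M[L]_m * seq 'M[L]_m :=
  if bs is (b, X) :: bs' then
    if b then
      ((carry X (sift bs').1).1, (carry X (sift bs').1).2 :: (sift bs').2)
    else (X :: (sift bs').1, (sift bs').2)
  else ([::], [::]).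

Fixpoint sift_dets bs : seq L :=
  if bs is (b, X) :: bs' then
    sift_dets bs' ++ (if b then carry_dets X (sift bs').1 else [::])
  else [::].

Lemma carry_dets_cons X Y s :
  carry_dets X (Y :: s) = swap_dets X Y ++ carry_dets (swap X Y).2 s.
Proof. by []. Qed.

Lemma sift_dets_cons b X bs :
  sift_dets ((b, X) :: bs)
  = sift_dets bs ++ (if b then carry_dets X (sift bs).1 else [::]).
Proof. by []. Qed.

Lemma sylvesterE X Y T :
  mxvec T *m sylvester X Y = mxvec (T *m X - Y *m T).
Proof. by rewrite mulmxBr !mul_vec_lin linearB. Qed.

Lemma sylvester_solP X Y (T := sylvester_sol X Y) :
  \det (sylvester X Y) != 0 -> T *m X - Y *m T = 1%:M.
Proof.
move=> nz; apply: (can_inj mxvecK); rewrite -sylvesterE /T /sylvester_sol.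
by rewrite vec_mxK mulmxKV // unitmxE unitfE.
Qed.

Lemma char_poly_mxM X Y :
  char_poly_mx X *m char_poly_mx Y
  = ('X ^+ 2)%:M - 'X *: map_mx polyC (X + Y) + map_mx polyC (X *m Y).
Proof.
rewrite /char_poly_mx mulmxBl !mulmxBr mul_scalar_mx mul_mx_scalar.
rewrite mul_scalar_mx scale_scalar_mx -expr2 map_mxD map_mxM scalerDr.
by rewrite opprB opprD -!addrA; congr (_ + _); rewrite [RHS]addrC -addrA.
Qed.

Lemma char_poly_conj S T X : T *m S = 1%:M -> char_poly (S *m X *m T) = char_poly X.
Proof.
move=> TS; rewrite /char_poly /char_poly_mx.
have STp : map_mx polyC S *m map_mx polyC T = 1%:M :> 'M[{poly L}]_m.
  by rewrite -map_mxM (mulmx1C TS) map_mx1.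
have -> : 'X%:M - map_mx polyC (S *m X *m T)
   = map_mx polyC S *m ('X%:M - map_mx polyC X) *m map_mx polyC T.
  by rewrite mulmxBr mulmxBl !map_mxM mul_mx_scalar -scalemxAl STp scalemx1.
by rewrite !det_mulmx mulrAC -det_mulmx STp det1 mul1r.
Qed.

(** Multiplying [T X - Y T = 1] by [S = T^-1] on the left, respectively on the
    right, shows that [X - S = S Y T] and [Y + S = T X S]. *)
Lemma swapP X Y : all (fun d => d != 0) (swap_dets X Y) ->
  [/\ char_poly_mx X *m char_poly_mx Y
      = char_poly_mx (swap X Y).1 *m char_poly_mx (swap X Y).2,
      char_poly (swap X Y).1 = char_poly Y
    & char_poly (swap X Y).2 = char_poly X].
Proof.
rewrite /= andbT => /andP[nzS nzT]; have := sylvester_solP nzS.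
move: nzT; rewrite /swap /=; set T := sylvester_sol X Y; set S := invmx T.
rewrite -unitfE -unitmxE => uT eqT.
have TS : T *m S = 1%:M by rewrite mulmxV.
have ST : S *m T = 1%:M by rewrite mulVmx.
have X'E : X - S = S *m Y *m T.
  have := congr1 (mulmx S) eqT.
  rewrite mulmxBr !mulmxA ST mul1mx mulmx1 => /eqP.
  by rewrite subr_eq => /eqP eX; rewrite {1}eX addrAC subrr add0r.
have Y'E : Y + S = T *m X *m S.
  have := congr1 (mulmxr S) eqT => /=.
  rewrite mulmxBl mul1mx -(mulmxA Y) TS mulmx1 => eS.
  by rewrite -{1}eS addrC subrK.
split; last 2 first.
- by rewrite X'E char_poly_conj.
- by rewrite Y'E char_poly_conj.
rewrite !char_poly_mxM addrACA addNr addr0; congr (_ + map_mx _ _).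
have SY : X *m S - S *m S = S *m Y.
  by rewrite -mulmxBl X'E -(mulmxA _ T) TS mulmx1.
by rewrite mulmxDr !mulmxBl SY subrK.
Qed.
End Swap.

Arguments swap : simpl never.

Section Sift.
Variables (L : fieldType) (m' : nat).
Local Notation m := m'.+1.
Implicit Types (X Y : 'M[L]_m) (s : seq 'M[L]_m) (bs : seq (bool * 'M[L]_m)).

Lemma carryP X s : all (fun d => d != 0) (carry_dets X s) ->
  [/\ char_poly_mx X * linprod s
      = linprod (carry X s).1 * char_poly_mx (carry X s).2,
      map (@char_poly L m) (carry X s).1 = map (@char_poly L m) s
    & char_poly (carry X s).2 = char_poly X].
Proof.
elim: s X => [|Y s IHs] X; first by rewrite /linprod big_nil mulr1 mul1r.
rewrite carry_dets_cons all_cat => /andP[/swapP[eqP cp1 cp2] /IHs[eqPs cps cpX]].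
split; last 2 first; first by rewrite /= cp1 cps.
  by rewrite cpX.
rewrite !linprod_cons mulrA; move: eqP; rewrite mulmxE => ->.
by rewrite -!mulrA eqPs.
Qed.

Lemma siftP bs : all (fun d => d != 0) (sift_dets bs) ->
  [/\ linprod (map snd bs) = linprod (sift bs).1 * linprod (sift bs).2,
      map (@char_poly L m) (sift bs).1 = [seq char_poly x.2 | x <- bs & ~~ x.1]
    & map (@char_poly L m) (sift bs).2 = [seq char_poly x.2 | x <- bs & x.1]].
Proof.
elim: bs => [|[[] X] bs IHs]; rewrite ?sift_dets_cons /=.
- by rewrite /linprod big_nil mulr1.
- rewrite all_cat => /andP[/IHs[eqP cp1 cp2] /carryP[eqQ cq1 cq2]].
  split; rewrite ?cq1 ?cq2 ?cp1 ?cp2 //.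
  by rewrite !linprod_cons mulrA -eqQ eqP mulrA.
rewrite cats0 => /IHs[eqP cp1 cp2].
by rewrite !linprod_cons eqP mulrA cp1 cp2.
Qed.

(** A list that is already sorted by label is not modified. *)
Lemma sift_pairwise bs :
  pairwise (fun x y => x.1 ==> y.1) bs -> (sift bs).2 = [seq x.2 | x <- bs & x.1].
Proof.
elim: bs => //= [[[] X] bs IHs] /= /andP[allbs pbs]; last exact: IHs.
have -> : (sift bs).1 = [::].
  by elim: bs allbs {IHs pbs} => //= [[[] Y] bs IHs] //= /IHs ->.
by rewrite /= IHs.
Qed.

End Sift.

(** * Conjugation and translation of linear factors *)

Lemma coprimep_bigprod (K : fieldType) (I J : eqType) (r : seq I) (s : seq J)
    (f : I -> {poly K}) (g : J -> {poly K}) :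
  (forall i j, i \in r -> j \in s -> coprimep (f i) (g j)) ->
  coprimep (\prod_(i <- r) f i) (\prod_(j <- s) g j).
Proof.
move=> co; rewrite big_seq; elim/big_ind: _ => [|p q cop coq|i ri].
- exact: coprime1p.
- by rewrite coprimepMl cop.
rewrite big_seq; elim/big_ind: _ => [|p q cop coq|j sj]; last exact: co.
- exact: coprimep1.
- by rewrite coprimepMr cop.
Qed.

Section ConjShift.
Variables (K : fieldType) (m' : nat).
Local Notation m := m'.+1.
Implicit Types (g X : 'M[K]_m) (c : K) (s : seq 'M[K]_m).

(** An automorphism of the matrix polynomials, [P(z) |-> g^-1 P(z - c) g], maps
    [z - X] to [z - conjshift g c X]. *)
Definition conjshift g c X : 'M[K]_m := invmx g *m X *m g + c%:M.

Definition conjshift_poly g c (P : 'M[{poly K}]_m) : 'M[{poly K}]_m :=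
  map_mx polyC (invmx g) *m map_mx (comp_poly ('X - c%:P)) P *m map_mx polyC g.

Lemma linprod_conjshift g c s : g \in unitmx ->
  linprod (map (conjshift g c) s) = conjshift_poly g c (linprod s).
Proof.
move=> ug; have gV : map_mx polyC (invmx g) *m map_mx polyC g = 1%:M :> 'M[{poly K}]_m.
  by rewrite -map_mxM mulVmx // map_mx1.
have Vg := mulmx1C gV.
elim: s => [|X s IHs]; rewrite /= ?linprod_cons.
  by rewrite /linprod big_nil /conjshift_poly map_mx1 mulmx1 gV.
rewrite IHs /conjshift_poly -!mulmxE map_mxM.
rewrite -[in RHS](mulmx1 (map_mx _ (char_poly_mx X))) -Vg !mulmxA.
congr (_ *m _ *m _ *m _).
rewrite /conjshift /char_poly_mx !(map_mxB, map_mxD, map_mxM) mulmxBr mulmxBl.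
have -> : map_mx (comp_poly ('X - c%:P)) (map_mx polyC X) = map_mx polyC X.
  by apply/matrixP=> i j; rewrite !mxE comp_polyC.
rewrite !map_scalar_mx /= comp_polyX mul_mx_scalar -scalemxAl gV.
by rewrite scalemx1 opprD addrA addrAC [in RHS]raddfB.
Qed.

Lemma linprod_map_conjshift g c s s' : g \in unitmx -> linprod s = linprod s' ->
  linprod (map (conjshift g c) s) = linprod (map (conjshift g c) s').
Proof. by move=> ug eqs; rewrite !linprod_conjshift ?eqs. Qed.

Lemma char_poly_conjshift g c X : g \in unitmx ->
  char_poly (conjshift g c X) = char_poly X \Po ('X - c%:P).
Proof.
move=> ug; have := linprod_conjshift c [:: X] ug; rewrite /linprod !big_seq1.
rewrite /char_poly => ->; rewrite !det_mulmx mulrAC -det_mulmx -map_mxM.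
by rewrite mulVmx // map_mx1 det1 mul1r det_map_mx.
Qed.

Lemma sum_conjshift g c s :
  \sum_(A <- map (conjshift g c) s) A
  = invmx g *m (\sum_(A <- s) A) *m g + (c *+ size s)%:M.
Proof.
elim: s => [|X s IHs]; first by rewrite !big_nil mulmx0 mul0mx raddf0 addr0.
by rewrite /= !big_cons IHs mulmxDr mulmxDl mulrS raddfD /= addrACA.
Qed.

Lemma linprod_sum s s' : linprod s = linprod s' -> size s = size s' ->
  \sum_(A <- s) A = \sum_(A <- s') A.
Proof.
move=> eqss' szs; have := linprod_cons 0 s; rewrite eqss'.
move=> /linprod_quotient_linear; rewrite /= szs => /(_ erefl)/char_poly_mx_inj.
by rewrite big_cons add0r => /esym/eqP; rewrite subr_eq0 => /eqP.
Qed.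

End ConjShift.

Lemma add_onesE n (k : 'rV[int]_n) (s : 'I_n) : (k + ones n) 0 s = k 0 s + 1%:Z.
Proof. by rewrite !mxE. Qed.

Lemma add_ebasisE n (k : 'rV[int]_n) (i s : 'I_n) :
  (k + ebasis i) 0 s = k 0 s + (s == i)%:Z.
Proof. rewrite !mxE /=. by case: (s == i). Qed.

(** * The window of particles *)
Section Window.
Variables (K : fieldType) (m' n N : nat).
Local Notation m := m'.+1.
Variable A0 : 'M[K]_m.
Implicit Types (C : 'I_n -> 'M[K]_m) (i : 'I_n) (k l : 'rV[int]_n).
Implicit Types (x y : nat * 'I_n).

Definition next_period : 'M[K]_m -> 'M[K]_m := conjshift A0 (- 1).
Definition prev_period : 'M[K]_m -> 'M[K]_m := conjshift (invmx A0) 1.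

(** The particle [(u, i)] is the factor of type [i] in the period [u - N], where
    period [0] holds the initial data [C].  Indices are moved by [N] to stay in
    [nat]. *)
Definition particle_mx C x : 'M[K]_m := iter x.1 next_period (iter N prev_period (C x.2)).

Definition period_row u : seq (nat * 'I_n) := [seq (u, i) | i <- enum 'I_n].

(** Higher periods stand further to the left. *)
Fixpoint particles W : seq (nat * 'I_n) :=
  if W is u.+1 then period_row u ++ particles u else [::].

(** The particles in the right factor [R_k] for the heights [k]. *)
Definition right_of k x : bool := (x.1%:Z < N%:Z + k 0 x.2)%R.

Definition labelled C k : seq (bool * 'M[K]_m) :=
  [seq (right_of k x, particle_mx C x) | x <- particles (2 * N)].

Definition left_factors C k := (sift (labelled C k)).1.
Definition right_factors C k := (sift (labelled C k)).2.

Definition rsum C k : 'M[K]_m := \sum_(A <- right_factors C k) A.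

(** The heights passed by the lattice path through [l]: the factor of type [i]
    is met on the edge from [upper i.+1 l] to [upper i l]. *)
Definition upper (j : nat) l : 'rV[int]_n := \row_s (l 0 s + (j <= s)%N%:Z).

Definition evolution C i l : 'M[K]_m := rsum C (upper i l) - rsum C (upper i.+1 l).

(** Asking this for every labelling, whether or not it comes from heights, makes
    the condition a conjunction over a finite type. *)
Definition regular_config C : Prop :=
  forall b : (size (particles (2 * N))).-tuple bool,
  all (fun d => d != 0) (sift_dets (zip b (map (particle_mx C) (particles (2 * N))))).

Lemma upperS i l : upper i l = upper i.+1 l + ebasis i.
Proof.
apply/rowP=> s; rewrite add_ebasisE !mxE -addrA; congr (_ + _).
by rewrite -PoszD leq_eqVlt eq_sym addnC; case: (ltngtP i s) => [||/val_inj->];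
  rewrite -val_eqE ?eqxx //=; lia.
Qed.

Lemma mem_particles W x : (x \in particles W) = (x.1 < W)%N.
Proof.
elim: W => //= u IHu; rewrite mem_cat IHu ltnS [RHS]leq_eqVlt; congr (_ || _).
case: x {IHu} => v i /=; apply/mapP/eqP => [[j _ [-> _]] //|->].
by exists i; rewrite ?mem_enum.
Qed.

Lemma uniq_particles W : uniq (particles W).
Proof.
elim: W => //= u IHu; rewrite cat_uniq IHu andbT; apply/andP; split.
  by rewrite map_inj_uniq ?enum_uniq // => i j [].
apply/hasPn=> x; rewrite mem_particles => ltxu; apply/mapP=> -[i _ eqx].
by move: ltxu; rewrite eqx /= ltnn.
Qed.

(** Advancing the window by one period exchanges the lowest period for a new one
    at the top. *)
Lemma particles_shift W :
  [seq (x.1.+1, x.2) | x <- particles W] ++ period_row 0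
  = period_row W ++ particles W.
Proof.
elim: W => [|u IHu] /=; first by rewrite cats0.
by rewrite map_cat -catA IHu -map_comp.
Qed.

Lemma particles_pairwise W :
  pairwise (fun x y => (y.1 < x.1)%N || (y.1 == x.1) && (x.2 < y.2)%N)
    (particles W).
Proof.
elim: W => //= u IHu; rewrite pairwise_cat IHu andbT; apply/andP; split.
  apply/allrelP=> x y /mapP[i _ ->]; rewrite mem_particles /= => ->.
  by [].
rewrite pairwise_map.
apply: (@sub_pairwise _ (relpre val ltn)) => [i j /= ->|].
  by rewrite eqxx orbT.
rewrite -pairwise_map val_enum_ord -sorted_pairwise.
  exact: iota_ltn_sorted.
exact: ltn_trans.
Qed.

Lemma right_of_step k i : 0 <= N%:Z + k 0 i -> k 0 i < N%:Z ->
  perm_eq [seq x <- particles (2 * N) | right_of (k + ebasis i) x]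
    ((absz (N%:Z + k 0 i), i) :: [seq x <- particles (2 * N) | right_of k x]).
Proof.
move=> ge0 ltN.
apply: uniq_perm; first by rewrite filter_uniq ?uniq_particles.
  rewrite /= filter_uniq ?uniq_particles // andbT mem_filter /right_of /=.
  by apply/negP; lia.
move=> [u j]; rewrite inE !mem_filter !mem_particles /right_of /= !mxE /=.
rewrite xpair_eqE; case: (j =P i) => [->|_] /=; rewrite ?eqxx ?andbT; first by lia.
by rewrite andbF addr0.
Qed.

(** For such heights the particles of [R_k] are a final segment of the window. *)
Lemma rsum_sorted C k : {homo (fun s => k 0 s) : s t / (s <= t)%N >-> s <= t} ->
  (forall s t, k 0 s <= k 0 t + 1%:Z) ->
  rsum C k = \sum_(x <- [seq x <- particles (2 * N) | right_of k x]) particle_mx C x.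
Proof.
move=> hk hk1; rewrite /rsum /right_factors sift_pairwise.
  by rewrite /labelled filter_map -map_comp big_map.
rewrite pairwise_map; apply: sub_pairwise (particles_pairwise (2 * N)) => x y /=.
move=> /orP[lt|/andP[/eqP eqxy lt]]; apply/implyP; rewrite /right_of.
  by have := hk1 x.2 y.2; lia.
by have := hk x.2 y.2 (ltnW lt); rewrite eqxy; lia.
Qed.

(** The heights [upper j 0] do not require any exchange, and the two sums differ
    by the factor of type [i] in the period [0]. *)
Lemma evolution0 C i : A0 \in unitmx -> (0 < N)%N -> evolution C i 0 = C i.
Proof.
move=> uA0 N0; have sorted_upper j : rsum C (upper j 0)
    = \sum_(x <- [seq x <- particles (2 * N) | right_of (upper j 0) x]) particle_mx C x.
  by apply: rsum_sorted => [s t|s t]; rewrite /= !mxE; lia.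
have eqi : upper i.+1 0 0 i = 0 by rewrite !mxE ltnn.
rewrite /evolution !sorted_upper upperS (perm_big _ (right_of_step _ _)) ?eqi //=.
rewrite big_cons addrK /particle_mx [_.1]addn0.
have next_periodK : cancel prev_period next_period.
  move=> X; rewrite /next_period /prev_period /conjshift invmxK mulmxDr mulmxDl !mulmxA.
  rewrite mulVmx // mul1mx -mulmxA mulVmx // mulmx1 mul_mx_scalar scale1r.
  by rewrite mulVmx // -addrA -raddfD subrr raddf0 addr0.
by elim: (N) => //= v IHv; rewrite -iterS iterSr next_periodK.
Qed.

End Window.

(** * Spectra, and how the right factors depend on the heights *)

Section Spectra.
Variables (K : numFieldType) (m' n N : nat).
Local Notation m := m'.+1.
Variables (A0 : 'M[K]_m) (uA0 : A0 \in unitmx).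
Variables (a : 'I_n -> 'I_m -> K) (aZ : no_integer_difference a).
Variable C : 'I_n -> 'M[K]_m.
Hypothesis charC : forall i, char_poly (C i) = \prod_p ('X - (a i p)%:P).
Hypothesis regC : regular_config N A0 C.
Implicit Types (i : 'I_n) (k l : 'rV[int]_n) (x y : nat * 'I_n).

(** The zeros of the determinant of the factor of the particle [x]: the
    eigenvalue drops by one when a period is gained. *)
Definition particle_zero x (p : 'I_m) : K := a x.2 p + (N%:R - x.1%:R).

Definition particle_char x : {poly K} := \prod_p ('X - (particle_zero x p)%:P).

(** Zeros of particles of different types, or coming from different eigenvalues,
    do not differ by integers; two particles of the same type have different
    periods. *)
Lemma particle_zero_neq x y : x != y ->
  forall p q, particle_zero x p != particle_zero y q.
Proof.
case: x y => [u i] [v j] neq_xy p q; rewrite /particle_zero /= eq_sym.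
have [[eqij eqpq]|] := altP ((j, q) =P (i, p)).
  apply: contraNneq neq_xy; rewrite eqij eqpq => /addrI/addrI/oppr_inj/eqP.
  by rewrite eqr_nat xpair_eqE eqxx andbT eq_sym.
move=> /aZ/(_ (v%:Z - u%:Z)); apply: contraNneq.
move=> eqc; apply/eqP; rewrite rmorphB /= -!pmulrn.
have -> : a j q - a i p = (a j q + (N%:R - v%:R)) - (a i p + (N%:R - u%:R))
  + (v%:R - u%:R) by ring.
by rewrite eqc subrr add0r.
Qed.

Lemma char_poly_conjshift_roots g c (X : 'M[K]_m) (b : 'I_m -> K) :
  g \in unitmx -> char_poly X = \prod_p ('X - (b p)%:P) ->
  char_poly (conjshift g c X) = \prod_p ('X - (b p + c)%:P).
Proof.
move=> ug cX; rewrite char_poly_conjshift // cX rmorph_prod.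
apply: eq_bigr => p _ /=; rewrite comp_polyB comp_polyX comp_polyC.
by rewrite polyCD opprD addrA addrAC.
Qed.

Lemma char_particle_mx x : char_poly (particle_mx N A0 C x) = particle_char x.
Proof.
case: x => u i; rewrite /particle_mx /particle_char /particle_zero /=.
have charN : char_poly (iter N (prev_period A0) (C i))
   = \prod_p ('X - (a i p + N%:R)%:P).
  elim: N => [|v IHv].
    by rewrite /= charC; apply: eq_bigr => p _; rewrite addr0.
  rewrite /= (char_poly_conjshift_roots _ _ IHv) ?unitmx_inv //.
  by apply: eq_bigr => p _; rewrite -addrA natr1.
elim: u => [|u IHu].
  by rewrite charN; apply: eq_bigr => p _; rewrite subr0.
rewrite /= (char_poly_conjshift_roots _ _ IHu) //; apply: eq_bigr => p _.
by rewrite -natr1 opprD !addrA.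
Qed.

Lemma coprime_particle_char x y : x != y -> coprimep (particle_char x) (particle_char y).
Proof.
move=> neq_xy; apply: coprimep_bigprod => p q _ _.
by apply: coprimep_XsubC2; rewrite subr_eq0 eq_sym particle_zero_neq.
Qed.

Lemma prod_particle_char_coprime (r s : seq (nat * 'I_n)) (P Q : pred (nat * 'I_n))
    (f g : nat * 'I_n -> nat * 'I_n) :
  (forall x y, P x -> Q y -> f x != g y) ->
  coprimep (\prod_(x <- [seq x <- r | P x]) particle_char (f x))
    (\prod_(y <- [seq y <- s | Q y]) particle_char (g y)).
Proof.
move=> neq; apply: coprimep_bigprod => x y; rewrite !mem_filter.
by move=> /andP[Px _] /andP[Qy _]; apply/coprime_particle_char/neq.
Qed.

Notation parts := (particles n (2 * N)).
Notation rl := (right_factors N A0 C).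
Notation ll := (left_factors N A0 C).
Notation zt := (rsum N A0 C).

Lemma regular_labelled k : all (fun d => d != 0) (sift_dets (labelled N A0 C k)).
Proof.
by have := regC (map_tuple (right_of N k) (in_tuple parts)); rewrite /= zip_map.
Qed.

Lemma linprod_all k : linprod (ll k) * linprod (rl k)
  = linprod (map (particle_mx N A0 C) parts).
Proof.
have [<- _ _] := siftP (regular_labelled k).
by rewrite /labelled -map_comp.
Qed.

Lemma map_char_right_factors k :
  [seq char_poly A | A <- rl k] = [seq particle_char x | x <- parts & right_of N k x].
Proof.
have [_ _ ->] := siftP (regular_labelled k).
rewrite /labelled filter_map -map_comp; apply: eq_map => x /=.
exact: char_particle_mx.
Qed.

Lemma map_char_left_factors k :
  [seq char_poly A | A <- ll k] = [seq particle_char x | x <- parts & ~~ right_of N k x].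
Proof.
have [_ -> _] := siftP (regular_labelled k).
rewrite /labelled filter_map -map_comp; apply: eq_map => x /=.
exact: char_particle_mx.
Qed.

Lemma size_right_factors k : size (rl k) = count (right_of N k) parts.
Proof.
by rewrite -(size_map (@char_poly K m)) map_char_right_factors size_map size_filter.
Qed.

Lemma det_right_factors k :
  \det (linprod (rl k)) = \prod_(x <- [seq x <- parts | right_of N k x]) particle_char x.
Proof.
rewrite det_linprod -(big_map (@char_poly _ _) xpredT id).
by rewrite map_char_right_factors big_map.
Qed.

Lemma det_left_factors k :
  \det (linprod (ll k))
  = \prod_(x <- [seq x <- parts | ~~ right_of N k x]) particle_char x.
Proof.
rewrite det_linprod -(big_map (@char_poly _ _) xpredT id).
by rewrite map_char_left_factors big_map.
Qed.

Lemma size_right_factors_step k i : 0 <= N%:Z + k 0 i -> k 0 i < N%:Z ->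
  size (rl (k + ebasis i)) = (size (rl k)).+1.
Proof.
move=> ge0 ltN; rewrite !size_right_factors -!size_filter.
by rewrite (perm_size (right_of_step ge0 ltN)).
Qed.

(** The right divisors for [k] and [k + e_i] have nested sets of particles, and
    the particles of the former are disjoint from those of the complement of
    the latter. *)
Lemma right_factors_step k i : 0 <= N%:Z + k 0 i -> k 0 i < N%:Z ->
  linprod (rl (k + ebasis i))
  = char_poly_mx (zt (k + ebasis i) - zt k) * linprod (rl k).
Proof.
move=> ge0 ltN; have szr := size_right_factors_step ge0 ltN.
apply: (right_divisor_step (P := linprod (ll k))
  (P' := linprod (ll (k + ebasis i)))) => //.
  by rewrite !linprod_all.
rewrite det_right_factors det_left_factors.
apply: (@prod_particle_char_coprime parts parts _ _ id id).
move=> x y xr; apply: contraNneq => <-; move: xr; rewrite /right_of add_ebasisE; lia.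
Qed.

(** Taking determinants in [right_factors_step] leaves the particle by which
    the two sets differ. *)
Lemma char_poly_step k i : 0 <= N%:Z + k 0 i -> k 0 i < N%:Z ->
  char_poly (zt (k + ebasis i) - zt k) = particle_char (absz (N%:Z + k 0 i), i).
Proof.
move=> ge0 ltN; have := congr1 determinant (right_factors_step ge0 ltN).
rewrite -mulmxE det_mulmx !det_right_factors (perm_big _ (right_of_step ge0 ltN)) /=.
rewrite big_cons -det_right_factors.
by move=> /(mulIf (monic_neq0 (det_linprod_monic _))).
Qed.

Definition in_window k : Prop := forall s, (- N%:Z <= k 0 s) && (k 0 s < N%:Z).

Lemma count_right_ones k : in_window k ->
  count (right_of N (k + ones n)) parts = (count (right_of N k) parts + n)%N.
Proof.
move=> wk; have := congr1 (count (right_of N (k + ones n))) (particles_shift n (2 * N)).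
rewrite !count_cat !count_map => eqc.
have e1 : count (preim (fun i : 'I_n => (0%N, i)) (right_of N (k + ones n)))
    (Finite.enum 'I_n) = n.
  rewrite -[RHS](size_enum_ord n) enumT -[RHS]count_predT; apply: eq_count => i /=.
  by have /andP[? ?] := wk i; rewrite /right_of /= ?add_onesE; apply/idP; lia.
have e2 : count (preim (fun i : 'I_n => (2 * N, i)%N) (right_of N (k + ones n)))
    (Finite.enum 'I_n) = 0%N.
  rewrite -[RHS](count_pred0 (Finite.enum 'I_n)); apply: eq_count => i /=.
  by have /andP[? ?] := wk i; rewrite /right_of /= ?add_onesE;
    apply/negbTE; rewrite -leNgt; lia.
move: eqc; rewrite ?map_id e1 e2 add0n => <-; congr (_ + _)%N.
by apply: eq_count => x; rewrite /right_of /= ?add_onesE; lia.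
Qed.

Let row_factors u := [seq particle_mx N A0 C x | x <- period_row n u].

Let size_row_factors u : size (row_factors u) = n.
Proof. by rewrite size_map size_map size_enum_ord. Qed.

(** Compare two right divisors of the window enlarged by the period [2 N]: the
    one for the heights [k + 1], and the image under [next_period] of the one
    for [k], completed on the right by the lowest period.  They have the same
    particles. *)
Lemma right_factors_quasi k : in_window k ->
  linprod (rl (k + ones n)) = linprod (map (next_period A0) (rl k) ++ row_factors 0).
Proof.
move=> wk.
pose P := linprod (row_factors (2 * N)) * linprod (ll (k + ones n)).
apply: (right_divisor_unique (P := P) (P' := linprod (map (next_period A0) (ll k)))).
- rewrite /P -mulrA linprod_all -linprod_cat -map_cat -particles_shift map_cat.
  rewrite !linprod_cat mulrA -[X in _ = X * _]linprod_cat -map_cat; congr (_ * _).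
  have -> : [seq particle_mx N A0 C x | x <- [seq (x.1.+1, x.2) | x <- parts]]
            = map (next_period A0) (map (particle_mx N A0 C) parts).
    by rewrite -!map_comp; apply: eq_map.
  by apply: linprod_map_conjshift => //; rewrite linprod_cat linprod_all.
- by rewrite size_cat size_map size_row_factors !size_right_factors count_right_ones.
rewrite det_right_factors det_linprod big_map.
rewrite (eq_bigr (fun X => char_poly X \Po ('X - (-1)%:P))) => [|X _]; last first.
  by rewrite char_poly_conjshift.
rewrite -(big_map (@char_poly _ _) xpredT (fun p => p \Po ('X - (-1)%:P))).
rewrite map_char_left_factors big_map.
rewrite [X in coprimep _ X](eq_bigr (fun x => particle_char (x.1.+1, x.2))) => [|x _].
  apply: (@prod_particle_char_coprime parts parts _ _ id (fun x => (x.1.+1, x.2))).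
  move=> x y; rewrite /right_of => xr yl; apply/eqP => exy.
  by move: xr yl; rewrite exy /= ?add_onesE; lia.
rewrite /particle_char /particle_zero rmorph_prod; apply: eq_bigr => p _ /=.
rewrite comp_polyB comp_polyX comp_polyC -natr1.
have -> : a x.2 p + (N%:R - (x.1%:R + 1)) = a x.2 p + (N%:R - x.1%:R) + (- 1).
  by ring.
by rewrite [in RHS]polyCD [in RHS]opprD (addrA 'X) addrAC.
Qed.

(** The contribution of the lowest period cancels in the difference, and the two
    lists of factors differ by one in length, whence the translation by [-1]. *)
Lemma rsum_step_quasi k i : in_window k -> in_window (k + ebasis i) ->
  zt (k + ones n + ebasis i) - zt (k + ones n)
  = conjshift A0 (- 1) (zt (k + ebasis i) - zt k).
Proof.
move=> wk wki.
have sumq l : in_window l -> zt (l + ones n) = invmx A0 *m zt l *m A0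
   + (- 1 *+ size (rl l))%:M + \sum_(A <- row_factors 0) A.
  move=> wl; rewrite /rsum (linprod_sum (right_factors_quasi wl)) ?big_cat ?sum_conjshift //.
  by rewrite size_cat size_map size_row_factors !size_right_factors count_right_ones.
rewrite addrAC !sumq // size_right_factors_step; last 2 first.
- by have := wk i; lia.
- by have := wk i; lia.
rewrite opprD addrACA subrr addr0 opprD addrACA mulrS raddfD /= addrK.
by rewrite /conjshift mulmxBr mulmxBl.
Qed.

End Spectra.

(** * The refactorization identity *)

Lemma Sp_roots (K : fieldType) m (A : 'M[K]_m) (b : 'I_m -> K) :
  char_poly A = \prod_p ('X - (b p)%:P) -> Sp A = range b.
Proof.
move=> cA; rewrite /Sp; apply/seteqP; split=> x /=.
  rewrite eigenvalue_root_char cA -(big_map b xpredT (fun z => 'X - z%:P)).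
  by rewrite root_prod_XsubC => /mapP[p _ ->]; exists p.
move=> [p _ <-]; rewrite eigenvalue_root_char cA.
rewrite -(big_map b xpredT (fun z => 'X - z%:P)) root_prod_XsubC.
by rewrite map_f // mem_index_enum.
Qed.

Lemma char_poly_Sp (K : fieldType) m (A : 'M[K]_m) (b : 'I_m -> K) :
  injective b -> Sp A = range b -> char_poly A = \prod_p ('X - (b p)%:P).
Proof.
move=> binj SpA; transitivity (\prod_(z <- map b (enum 'I_m)) ('X - z%:P)); last first.
  by rewrite big_map big_enum.
rewrite [LHS](@all_roots_prod_XsubC _ _ (map b (enum 'I_m))).
- by rewrite (monicP (char_poly_monic A)) scale1r.
- by rewrite size_char_poly size_map size_enum_ord.
- apply/allP=> x /mapP[p _ ->]; rewrite -eigenvalue_root_char.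
  by have : Sp A (b p) by rewrite SpA; exists p.
- by rewrite uniq_rootsE map_inj_uniq ?enum_uniq.
Qed.

Lemma filter_ord_cons (n a b : nat) (ltan : (a < n)%N) : (a < b)%N ->
  [seq s : 'I_n <- enum 'I_n | (a <= s < b)%N]
  = Ordinal ltan :: [seq s : 'I_n <- enum 'I_n | (a < s < b)%N].
Proof.
move=> ltab; pose r := relpre (@nat_of_ord n) ltn.
have rtr : transitive r by move=> x y z; apply: ltn_trans.
have rirr : irreflexive r by move=> x; apply: ltnn.
have rs : sorted r (enum 'I_n).
  by rewrite -sorted_map val_enum_ord iota_ltn_sorted.
apply: (irr_sorted_eq rtr rirr).
- exact: sorted_filter.
- rewrite /= path_sortedE // sorted_filter // andbT.
  by apply/allP=> s; rewrite mem_filter => /andP[/andP[]].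
by move=> s; rewrite mem_filter mem_enum in_cons mem_filter mem_enum -val_eqE inE /=; lia.
Qed.

Section Refactorization.
Variables (K : fieldType) (m' n : nat).
Local Notation m := m'.+1.
Variables (A0 : 'M[K]_m) (uA0 : A0 \in unitmx).
Implicit Types (D : mfamily K n m) (l : 'rV[int]_n).

(** Moving [A0] to the right end turns either side of (i) into a product of
    linear factors times [A0].  Its letters are the [D_s - 1] for [s >= j],
    followed by the [A0 D_s A0^-1] for [s < j], with [j = i] on the left hand
    side and [j = i + 1] on the right hand side. *)
Definition wordl (j : nat) (D : 'I_n -> 'M[K]_m) : seq 'M[K]_m :=
  map (conjshift 1%:M (- 1)) [seq D s | s : 'I_n <- enum 'I_n & (j <= s)%N].

Definition wordr (j : nat) (D : 'I_n -> 'M[K]_m) : seq 'M[K]_m :=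
  map (conjshift (invmx A0) 0) [seq D s | s : 'I_n <- enum 'I_n & (s < j)%N].

Definition word (j : nat) (D : 'I_n -> 'M[K]_m) := wordl j D ++ wordr j D.

Lemma linprod_enum (P : pred 'I_n) (D : 'I_n -> 'M[K]_m) :
  linprod [seq D s | s : 'I_n <- enum 'I_n & P s]
  = \prod_(s < n | P s) char_poly_mx (D s).
Proof. rewrite /linprod big_map. by rewrite big_filter enumT. Qed.

Lemma linfac1E (A : 'M[K]_m) : linfac 1 A = char_poly_mx (conjshift 1%:M (- 1) A).
Proof.
rewrite /linfac /char_poly_mx /conjshift invmx1 mul1mx mulmx1 map_mxD.
by rewrite !raddfN /= map_scalar_mx /= raddfD /= opprD opprK addrAC addrA.
Qed.

Lemma linfac0E (A : 'M[K]_m) : linfac 0 A = char_poly_mx A.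
Proof. by rewrite /linfac addr0. Qed.

Lemma conj_linprod s : map_mx polyC A0 * linprod s
  = linprod (map (conjshift (invmx A0) 0) s) * map_mx polyC A0.
Proof.
rewrite linprod_conjshift ?unitmx_inv // /conjshift_poly invmxK -!mulmxE.
rewrite -!mulmxA -map_mxM mulVmx // map_mx1 mulmx1; congr (_ *m _).
apply/matrixP=> i j; rewrite !mxE polyC0 subr0.
by rewrite comp_polyXr.
Qed.

Lemma wordE j (D : 'I_n -> 'M[K]_m) :
  \prod_(s < n | (j <= s)%N) linfac 1 (D s) *m map_mx polyC A0
    *m \prod_(s < n | (s < j)%N) linfac 0 (D s)
  = linprod (word j D) * map_mx polyC A0.
Proof.
rewrite (eq_bigr _ (fun s _ => linfac1E (D s))).
rewrite (eq_bigr _ (fun s _ => linfac0E (D s))).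
rewrite /word /wordl linprod_cat -map_comp -!linprod_enum -mulmxA !mulmxE.
by rewrite conj_linprod mulrA.
Qed.

Lemma refactorizationP M D : refactorization M A0 D <->
  forall i l, in_box M l -> in_box M (l + ebasis i) ->
  linprod (word i (D^~ l)) = linprod (word i.+1 (D^~ (l + ebasis i))).
Proof.
have A0inj : injective (fun P : 'M[{poly K}]_m => P * map_mx polyC A0).
  move=> P Q /(congr1 (mulmxr (map_mx polyC (invmx A0)))) /=.
  by rewrite -!mulmxE -!mulmxA -map_mxM mulmxV // map_mx1 !mulmx1.
have E i l l' :
  (\prod_(j < n | (i <= j)%N) linfac 1 (D j l) *m map_mx polyC A0
      *m \prod_(j < n | (j < i)%N) linfac 0 (D j l)
   = \prod_(j < n | (i < j)%N) linfac 1 (D j l') *m map_mx polyC A0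
      *m \prod_(j < n | (j <= i)%N) linfac 0 (D j l'))
  <-> (linprod (word i (D^~ l)) = linprod (word i.+1 (D^~ l'))).
  rewrite (wordE i (D^~ l)) (wordE i.+1 (D^~ l')).
  by split=> [/A0inj //|->].
by split=> H i l bl bli; apply/E; apply: H.
Qed.

End Refactorization.

Section Solution.
Variables (K : numFieldType) (m' n M N : nat).
Local Notation m := m'.+1.
Variables (A0 : 'M[K]_m) (uA0 : A0 \in unitmx).
Variables (a : 'I_n -> 'I_m -> K) (aZ : no_integer_difference a).
Variable C : 'I_n -> 'M[K]_m.
Hypothesis charC : forall i, char_poly (C i) = \prod_p ('X - (a i p)%:P).
Hypothesis regC : regular_config N A0 C.
Hypothesis leMN : (M + 3 <= N)%N.
Implicit Types (i : 'I_n) (k l : 'rV[int]_n).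

Local Notation D := (evolution N A0 C).
Local Notation rl := (right_factors N A0 C).
Local Notation zt := (rsum N A0 C).

Lemma in_window_upper j l : in_box M.+1 l -> in_window N (upper j l).
Proof. by move=> bl s; have := bl s; rewrite !mxE; lia. Qed.

Lemma in_boxS l : in_box M l -> in_box M.+1 l.
Proof. by move=> bl s; apply/leqW/bl. Qed.

Lemma upper_self i l : upper i.+1 l 0 i = l 0 i.
Proof. by rewrite !mxE ltnn addr0. Qed.

Lemma upper_shift j l : upper j (l + ones n) = upper j l + ones n.
Proof. by apply/rowP=> s; rewrite add_onesE mxE add_onesE mxE addrAC. Qed.

Lemma evolution_char i l : in_box M l ->
  char_poly (D i l) = \prod_p ('X - (a i p - (l 0 i)%:~R)%:P).
Proof.
move=> bl; have wl := in_window_upper i.+1 (in_boxS bl).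
have /andP[ge0 ltN] := wl i.
rewrite /evolution upperS (char_poly_step uA0 aZ charC regC) //; last by lia.
rewrite /particle_char /particle_zero /= upper_self; rewrite upper_self in ge0.
apply: eq_bigr => p _; congr ('X - (_ + _)%:P).
rewrite natr_absz ger0_norm; last by lia.
by rewrite rmorphD /= opprD addrA -pmulrn subrr add0r.
Qed.

Lemma evolution_quasi i l : in_box M.+1 l ->
  D i (l + ones n) = conjshift A0 (- 1) (D i l).
Proof.
move=> bl; rewrite /evolution !upper_shift upperS addrAC.
apply: (rsum_step_quasi uA0 aZ charC regC); first exact: in_window_upper.
by rewrite -upperS; apply: in_window_upper.
Qed.

(** Composing the steps of types [y - 1], ..., [x]. *)
Lemma right_factors_telescope (x y : nat) l : (x <= y <= n)%N -> in_box M.+1 l ->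
  linprod [seq D s l | s : 'I_n <- enum 'I_n & (x <= s < y)%N] * linprod (rl (upper y l))
  = linprod (rl (upper x l)).
Proof.
move=> /andP[lexy leyn] bl; have [d] := ubnP (y - x)%N.
elim: d x lexy => // d IHd x lexy ltd.
case: (ltngtP x y) lexy => // [ltxy|->] _; last first.
  rewrite (eq_filter (a2 := pred0)) => [|s]; last by rewrite /=; lia.
  by rewrite filter_pred0 /linprod big_nil mul1r.
have ltxn := leq_trans ltxy leyn.
rewrite (filter_ord_cons ltxn ltxy) /= linprod_cons -mulrA IHd //; last by lia.
have wl := in_window_upper x.+1 bl (Ordinal ltxn).
rewrite (upperS (Ordinal ltxn)) (right_factors_step uA0 aZ charC regC) //=; last 2 first.
- by move: wl; lia.
- by move: wl => /andP[].
by rewrite /evolution -(upperS (Ordinal ltxn)).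
Qed.

(** By quasi-periodicity the conjugates in a word are the factors met one period
    earlier, so a word is the product along a path of [n] steps, one of each
    type.  The words for [l] and for [l + e_i] join the same two points. *)
Lemma evolution_refactorization : refactorization M A0 D.
Proof.
apply/refactorizationP => // i l bl bli.
pose lm k : 'rV[int]_n := k - ones n.
have lmE k : lm k + ones n = k by rewrite subrK.
have blm k : in_box M k -> in_box M.+1 (lm k).
  move=> bk s; have := bk s; have := add_onesE (lm k) s; rewrite lmE.
  by move: (lm k 0 s) (k 0 s) => x y; lia.
(* [s] lists the factors along the path from [upper j (k - 1)] to [upper j k]. *)
have wE j k : in_box M k -> (j <= n)%N ->
  exists s : seq 'M[K]_m, word A0 j (D^~ k) = map (conjshift 1%:M (- 1)) s /\
    linprod s * linprod (rl (upper j (lm k))) = linprod (rl (upper j k)).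
  move=> bk lejn.
  exists ([seq D s k | s : 'I_n <- enum 'I_n & (j <= s)%N]
          ++ [seq D s (lm k) | s : 'I_n <- enum 'I_n & (s < j)%N]); split.
    rewrite map_cat; congr (_ ++ _); rewrite /wordr -!map_comp.
    apply: eq_map => s /=; rewrite -{1}(lmE k) evolution_quasi; last exact: blm.
    rewrite /conjshift invmxK invmx1 mul1mx mulmx1 mulmxDr mulmxDl !mulmxA.
    rewrite mulmxV // mul1mx -mulmxA mulmxV // mulmx1 mul_mx_scalar -scalemxAl.
    by rewrite mulmxV // scalemx1 raddf0 addr0.
  rewrite linprod_cat -mulrA.
  have := @right_factors_telescope 0 j (lm k) _ (blm _ bk); rewrite leq0n lejn => -> //.
  have -> : upper 0 (lm k) = upper n k.
    apply/rowP=> s; transitivity (k 0 s); last by rewrite mxE leqNgt ltn_ord addr0.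
    by rewrite mxE leq0n -(add_onesE (lm k)) lmE.
  have := @right_factors_telescope j n k _ (in_boxS bk); rewrite lejn leqnn => <- //.
  congr (linprod (map _ _) * _); apply: eq_filter => s.
  by rewrite ltn_ord andbT.
have [s [-> eqs]] := wE i l bl (ltnW (ltn_ord i)).
have [s' [-> eqs']] := wE i.+1 (l + ebasis i) bli (ltn_ord i).
apply: linprod_map_conjshift; first exact: unitmx1.
apply: (@linprod_rcancel _ _ (rl (upper i (lm l)))) => /=.
rewrite eqs.
have up k : upper i.+1 (k + ebasis i) = upper i k.
  rewrite upperS; apply/rowP=> t; rewrite add_ebasisE !mxE /=.
  by rewrite addrAC; congr (_ + _ + _); case: (t == i).
by rewrite -up -eqs' /lm addrAC up.
Qed.

End Solution.

(** * The constructed family is a solution *)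

Section SolutionProperties.
Variables (K : numFieldType) (m' n M N : nat).
Local Notation m := m'.+1.
Variables (A0 : 'M[K]_m) (uA0 : A0 \in unitmx).
Variables (a : 'I_n -> 'I_m -> K) (aZ : no_integer_difference a).
Variable C : 'I_n -> 'M[K]_m.
Hypothesis charC : forall i, char_poly (C i) = \prod_p ('X - (a i p)%:P).
Hypothesis regC : regular_config N A0 C.
Hypothesis leMN : (M + 3 <= N)%N.
Implicit Types (i : 'I_n) (k l : 'rV[int]_n).

Local Notation D := (evolution N A0 C).
Local Notation rl := (right_factors N A0 C).
Local Notation zt := (rsum N A0 C).

Lemma evolution_spectra : shifted_spectra M C D.
Proof.
move=> i l bl; rewrite (Sp_roots (evolution_char uA0 aZ charC regC leMN i bl)).
by rewrite (Sp_roots (charC i)) image_comp.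
Qed.

Lemma evolution_solution : is_solution M A0 C D.
Proof.
split; [exact: (evolution_refactorization uA0 aZ charC regC)
  | exact: evolution_spectra |].
by move=> i; apply: evolution0 => //; lia.
Qed.

Lemma evolution_quasiperiodic : quasiperiodic M A0 D.
Proof.
move=> i l bl _; rewrite (evolution_quasi uA0 aZ charC regC leMN) ?/conjshift.
  by rewrite raddfN.
exact: in_boxS.
Qed.

(** This is the reason for the shifts of indices in the definition of [B_i]. *)
Lemma Bmx_evolution i k : Bmx D i k = zt (k + ebasis i) - zt k.
Proof.
rewrite /Bmx /evolution upperS; suff -> : upper i.+1 (lower_after i k) = k by [].
by apply/rowP=> s; rewrite !mxE natz subrK.
Qed.

(** The first equation says that the second difference of [rsum] is symmetric.
    In the second one, both products of linear factors are the quotient of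
    [R_(k + e_i + e_j)] by [R_k]; compare the constant terms. *)
Lemma evolution_schlesinger : difference_schlesinger M A0 D.
Proof.
split=> [i j k bi bij bj bji|i k bi bi1]; last first.
  rewrite /Bmx; suff -> : lower_after i (k + ones n) = lower_after i k + ones n.
    apply: evolution_quasiperiodic => //; move: bi1; rewrite /B_defined.
    by congr (in_box _ _); apply/rowP=> s; rewrite !mxE addrAC.
  by apply/rowP=> s; rewrite !mxE addrAC.
have eq1 : Bmx D i k - Bmx D i (k + ebasis j) = Bmx D j k - Bmx D j (k + ebasis i).
  rewrite !Bmx_evolution [k + ebasis j + _]addrAC.
  by rewrite !opprB addrACA [RHS]addrACA; congr (_ + _); apply: addrC.
split=> //.
have [->//|neqij] := eqVneq i j.
have wb k' t : B_defined M t k' -> (0 <= N%:Z + k' 0 t) /\ (k' 0 t < N%:Z).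
  by move=> /(_ t); rewrite /lower_after mxE ltnn subr0; lia.
have [gi li] := wb _ _ bi; have [gj lj] := wb _ _ bj.
have [gij lij] := wb _ _ bij; have [gji lji] := wb _ _ bji.
have step t k' := right_factors_step uA0 aZ charC regC (k := k') (i := t).
have eq2 : linprod (rl (k + ebasis i + ebasis j)) = linprod (rl (k + ebasis j + ebasis i)).
  by rewrite addrAC.
move: eq2; rewrite (step j _ gji lji) (step i k gi li) (step i _ gij lij) (step j k gj lj).
rewrite -!Bmx_evolution !mulrA => /linprod_rcancel; rewrite -!mulmxE !char_poly_mxM.
have -> : Bmx D j (k + ebasis i) + Bmx D i k = Bmx D i (k + ebasis j) + Bmx D j k.
  move/eqP: eq1; rewrite subr_eq => /eqP ->.
  by rewrite addrA (addrC _ (Bmx D j k - _)) subrK addrC.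
move=> /addrI/matrixP eq3; apply/matrixP=> p q.
by have := eq3 p q; rewrite !mxE => /polyC_inj.
Qed.

End SolutionProperties.

(** * Uniqueness of solutions *)

Section Uniqueness.
Variables (K : numFieldType) (m' n M : nat).
Local Notation m := m'.+1.
Variables (A0 : 'M[K]_m) (uA0 : A0 \in unitmx).
Variables (a : 'I_n -> 'I_m -> K) (aZ : no_integer_difference a).
Variable C : mtuple K n m.
Hypothesis SpC : prescribed a C.
Implicit Types (i j s : 'I_n) (k l : 'rV[int]_n) (D : mfamily K n m).

Lemma spectrum_inj i : injective (a i).
Proof.
move=> p q eqpq; apply/eqP; apply: contraT => neqpq.
have /aZ/(_ 0) : (i, p) != (i, q) by rewrite xpair_eqE eqxx.
by rewrite eqpq subrr eqxx.
Qed.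

Lemma char_poly_prescribed i : char_poly (C i) = \prod_p ('X - (a i p)%:P).
Proof. exact: char_poly_Sp (@spectrum_inj i) (SpC i). Qed.

Lemma char_poly_solution D i l : is_solution M A0 C D -> in_box M l ->
  char_poly (D i l) = \prod_p ('X - (a i p - (l 0 i)%:~R)%:P).
Proof.
case=> _ sp _ bl; apply: (@char_poly_Sp _ _ _ (fun p => a i p - (l 0 i)%:~R)).
  by move=> p q /addIr/spectrum_inj.
by rewrite sp // (SpC i) image_comp.
Qed.

Definition word_order (x : nat) : seq 'I_n :=
  [seq s : 'I_n <- enum 'I_n | (x <= s)%N] ++ [seq s : 'I_n <- enum 'I_n | (s < x)%N].

Definition word_letter (x : nat) s : 'M[K]_m -> 'M[K]_m :=
  if (x <= s)%N then conjshift 1%:M (- 1) else conjshift (invmx A0) 0.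

Lemma word_letters x (E : 'I_n -> 'M[K]_m) :
  word A0 x E = [seq word_letter x s (E s) | s <- word_order x].
Proof.
rewrite map_cat /word /wordl /wordr -!map_comp; congr (_ ++ _).
  by apply/eq_in_map => s; rewrite mem_filter /word_letter /= => /andP[->].
apply/eq_in_map => s; rewrite mem_filter /word_letter /= => /andP[+ _].
by rewrite ltnNge => /negbTE->.
Qed.

Lemma mem_word_order x s : s \in word_order x.
Proof. by rewrite mem_cat mem_filter mem_enum mem_filter mem_enum !andbT leqNgt orNb. Qed.

Lemma uniq_word_order x : uniq (word_order x).
Proof.
rewrite cat_uniq; apply/and3P; split; try exact/filter_uniq/enum_uniq.
by apply/hasPn=> s; rewrite mem_filter => /andP[ltsx _] /=;
  rewrite mem_filter leqNgt ltsx.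
Qed.

Lemma conjshift_inj g c : g \in unitmx -> injective (@conjshift K m' g c).
Proof.
move=> ug X Y /addIr eqXY.
have /(congr1 (fun Z => g *m Z *m invmx g)) := eqXY.
by rewrite !mulmxA !(mulmxV ug) !mul1mx -!mulmxA (mulmxV ug) !mulmx1.
Qed.

(** The letters of a word have prescribed spectra without common points, because
    letters of different types come from eigenvalues that do not differ by an
    integer. *)
Lemma word_inj x D D' l : in_box M l ->
  is_solution M A0 C D -> is_solution M A0 C D' ->
  linprod (word A0 x (D^~ l)) = linprod (word A0 x (D'^~ l)) ->
  forall s, D s l = D' s l.
Proof.
move=> bl solD solD'; pose q s : {poly K} :=
  \prod_p ('X - (a s p - (l 0 s + (x <= s)%N%:Z)%:~R)%:P).
have qE E s : is_solution M A0 C E -> char_poly (word_letter x s (E s l)) = q s.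
  move=> solE; have cE := char_poly_solution s solE bl.
  rewrite /word_letter /q; case: (x <= s)%N.
    rewrite (char_poly_conjshift_roots _ (unitmx1 _ _) cE); apply: eq_bigr => p _.
    by rewrite [in RHS]intrD [in RHS]opprD addrA.
  rewrite (char_poly_conjshift_roots _ _ cE) ?unitmx_inv //.
  by apply: eq_bigr => p _; rewrite !addr0.
rewrite !word_letters => /linprod_inj.
rewrite -!map_comp (eq_map (g := q)); last by move=> s /=; rewrite qE.
rewrite [X in _ -> _ = X -> _](eq_map (g := q)); last by move=> s /=; rewrite qE.
move=> inj; have := inj _ erefl => /(_ _)/eq_in_map inj' s.
have := inj' _ s (mem_word_order x s); rewrite /word_letter => inj''.
have {inj inj' inj''} : word_letter x s (D s l) = word_letter x s (D' s l).
  apply: inj''; rewrite pairwise_map; have := uniq_word_order x.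
  rewrite uniq_pairwise; apply: sub_pairwise => s1 s2 /= neq12.
  apply: coprimep_bigprod => p1 p2 _ _; apply: coprimep_XsubC2; rewrite subr_eq0.
  have /aZ : (s2, p2) != (s1, p1) by rewrite xpair_eqE eq_sym (negbTE neq12).
  move=> /(_ (l 0 s2 + (x <= s2)%N%:Z - (l 0 s1 + (x <= s1)%N%:Z))).
  apply: contraNneq; rewrite rmorphB /= => /eqP.
  set u := _%:~R; set v := _%:~R; rewrite subr_eq => /eqP ->.
  by apply/eqP; ring.
rewrite /word_letter; case: ifP => _; apply: conjshift_inj.
  exact: unitmx1.
by rewrite unitmx_inv.
Qed.

(** Every point of the box is joined to the origin by unit steps inside the box.
    A step is determined in both directions: forwards by the right hand side of
    (i), backwards by its left hand side. *)
Lemma solution_unique D D' : is_solution M A0 C D -> is_solution M A0 C D' ->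
  forall i l, in_box M l -> D' i l = D i l.
Proof.
move=> solD solD' i l bl; have [d] := ubnP (\sum_s absz (l 0%R s))%N.
elim: d l bl i => // d IHd l bl i ltd.
have [/eqP l0|[s ls0]] : (l == 0) \/ exists s, l 0 s != 0.
  have [->|/rV0Pn ?] := eqVneq l 0; first by left.
  by right.
  rewrite l0; by case: solD solD' => _ _ -> [_ _ ->].
have shrink (c : int) : absz (l 0 s) = (absz (l 0 s + c)).+1 ->
    (\sum_t absz (l 0%R t) < d.+1)%N ->
  (\sum_t absz ((l + c *: ebasis s)%R 0%R t) < d)%N.
  move=> eqc; rewrite !(bigD1 s (P := xpredT)) //= eqc !mxE !eqxx /= mulr1 addSn ltnS.
  congr (_ + _ < _)%N; apply: eq_bigr => t /negbTE neqt.
  by rewrite !mxE neqt mulr0 addr0.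
have boxc (c : int) : absz (l 0 s) = (absz (l 0 s + c)).+1 -> in_box M (l + c *: ebasis s).
  move=> eqc t; rewrite !mxE /=; have [->|_] := eqVneq t s.
    by rewrite mulr1; apply: leq_trans (bl s); rewrite eqc.
  by rewrite mulr0 addr0; apply: bl.
have [rD _ _] := solD; have [rD' _ _] := solD'.
move/(refactorizationP uA0): (rD) => wD; move/(refactorizationP uA0): (rD') => wD'.
case: (ltgtP (l 0 s) 0) ls0 => // sgn _.
  have eqc : absz (l 0 s) = (absz (l 0 s + 1)).+1 by lia.
  have bc := boxc _ eqc; have IH t := IHd _ bc t (shrink _ eqc ltd).
  move: bc IH; rewrite scale1r => bc IH.
  apply: (word_inj (x := s) bl solD' solD).
  rewrite wD // wD' //; congr (linprod (word _ _ _)); apply/funext => t; exact: IH.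
have eqc : absz (l 0 s) = (absz (l 0 s + (- 1))).+1 by lia.
have bc := boxc _ eqc; have IH t := IHd _ bc t (shrink _ eqc ltd).
set l' := l + _ in bc IH; have ll' : l = l' + ebasis s.
  by rewrite /l' scaleN1r subrK.
apply: (word_inj (x := s.+1) bl solD' solD).
rewrite ll' -wD -?wD' -?ll' //; congr (linprod (word _ _ _)).
by apply/funext => t; apply: IH.
Qed.

End Uniqueness.

(** * Regular rational functions at a point *)

Section LocalRing.
Variables (K : fieldType) (n m : nat) (C : mtuple K n m).
Local Notation L := (ratfun K n m).
Implicit Types (f g : L) (u v : K) (P Q : epoly K n m).

Local Notation eval P := (epoly_eval P C).

Lemma epoly_evalM P Q : eval (P * Q) = eval P * eval Q.
Proof. exact: mevalM. Qed.

Lemma epoly_evalD P Q : eval (P + Q) = eval P + eval Q.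
Proof. exact: mevalD. Qed.

Lemma epoly_eval_neq0 P : eval P != 0 -> tofrac P != 0 :> L.
Proof.
by apply: contra; rewrite tofrac_eq0 => /eqP->; rewrite /epoly_eval meval0.
Qed.

Lemma ratfun_value_poly P : ratfun_value (tofrac P) C (eval P).
Proof.
have e1 : eval 1 = 1 by exact: meval1.
by exists P, 1; rewrite tofrac1 divr1 e1 divr1 oner_neq0.
Qed.

Lemma ratfun_valueD f g u v : ratfun_value f C u -> ratfun_value g C v ->
  ratfun_value (f + g) C (u + v).
Proof.
move=> [P [Q [-> Q0 ->]]] [P' [Q' [-> Q'0 ->]]].
exists (P * Q' + P' * Q), (Q * Q'); split.
- rewrite tofracD !tofracM addf_div //; exact: epoly_eval_neq0.
- by rewrite epoly_evalM mulf_neq0.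
- by rewrite epoly_evalD !epoly_evalM addf_div.
Qed.

Lemma ratfun_valueM f g u v : ratfun_value f C u -> ratfun_value g C v ->
  ratfun_value (f * g) C (u * v).
Proof.
move=> [P [Q [-> Q0 ->]]] [P' [Q' [-> Q'0 ->]]].
exists (P * P'), (Q * Q'); split.
- by rewrite !tofracM mulf_div.
- by rewrite epoly_evalM mulf_neq0.
- by rewrite !epoly_evalM mulf_div.
Qed.

Lemma ratfun_value_const (c : K) : ratfun_value (tofrac (c%:MP_[_])) C c.
Proof. by have := ratfun_value_poly c%:MP_[_]; rewrite /epoly_eval mevalC. Qed.

Lemma ratfun_value0 : ratfun_value 0 C 0.
Proof. by have := ratfun_value_const 0; rewrite mpolyC0 tofrac0. Qed.

Lemma ratfun_value1 : ratfun_value 1 C 1.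
Proof. by have := ratfun_value_const 1; rewrite mpolyC1 tofrac1. Qed.

Lemma ratfun_valueN f u : ratfun_value f C u -> ratfun_value (- f) C (- u).
Proof.
move=> fu; rewrite -mulN1r -[- u]mulN1r; apply: ratfun_valueM => //.
by have := ratfun_value_const (-1); rewrite mpolyCN mpolyC1 tofracN tofrac1.
Qed.

(** The units of the local ring of [C]. *)
Definition unit_germ f : Prop :=
  exists P Q, [/\ f = tofrac P / tofrac Q, eval P != 0 & eval Q != 0].

(** A numerator and denominator witnessing that [f] is a unit need not be those
    that give its value; cross-multiplying compares them. *)
Lemma unit_germ_value f u : ratfun_value f C u -> `[< unit_germ f >] = (u != 0).
Proof.
move=> [P [Q [-> Q0 ->]]]; apply/asboolP/idP => [[P' [Q' [eqf P'0 Q'0]]]|].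
  have : tofrac (P * Q') == tofrac (P' * Q) :> L.
    by rewrite !tofracM -eqr_div ?eqf // epoly_eval_neq0.
  rewrite tofrac_eq => /eqP/(congr1 (fun R => eval R)).
  rewrite !epoly_evalM => eqPQ; apply: mulf_neq0; last by rewrite invr_eq0.
  apply: contraNneq (mulf_neq0 P'0 Q0) => P0.
  by rewrite -eqPQ P0 mul0r.
by rewrite mulf_eq0 negb_or => /andP[P0 _]; exists P, Q.
Qed.

Lemma unit_germ_neq0 f : unit_germ f -> f != 0.
Proof.
by move=> [P [Q [-> P0 Q0]]]; rewrite mulf_neq0 ?invr_eq0 ?epoly_eval_neq0.
Qed.

Lemma ratfun_valueV f u : ratfun_value f C u -> u != 0 -> ratfun_value f^-1 C u^-1.
Proof.
move=> [P [Q [-> Q0 ->]]]; rewrite mulf_eq0 negb_or => /andP[P0 _].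
by exists Q, P; rewrite !invf_div.
Qed.

Lemma ratfun_value_sum (I : Type) (r : seq I) (p : pred I) (F : I -> L) (G : I -> K) :
  (forall i, p i -> ratfun_value (F i) C (G i)) ->
  ratfun_value (\sum_(i <- r | p i) F i) C (\sum_(i <- r | p i) G i).
Proof.
move=> FG; apply: (big_ind2 (fun f u => ratfun_value f C u)) => //.
  exact: ratfun_value0.
by move=> f u g v; apply: ratfun_valueD.
Qed.

Lemma ratfun_value_prod (I : Type) (r : seq I) (p : pred I) (F : I -> L) (G : I -> K) :
  (forall i, p i -> ratfun_value (F i) C (G i)) ->
  ratfun_value (\prod_(i <- r | p i) F i) C (\prod_(i <- r | p i) G i).
Proof.
move=> FG; apply: (big_ind2 (fun f u => ratfun_value f C u)) => //.
  exact: ratfun_value1.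
by move=> f u g v; apply: ratfun_valueM.
Qed.

Definition mx_value d e (A : 'M[L]_(d, e)) (B : 'M[K]_(d, e)) : Prop :=
  forall p q, ratfun_value (A p q) C (B p q).

Lemma mx_valueD d e (A A' : 'M[L]_(d, e)) B B' :
  mx_value A B -> mx_value A' B' -> mx_value (A + A') (B + B').
Proof. by move=> AB AB' p q; rewrite !mxE; apply: ratfun_valueD. Qed.

Lemma mx_valueN d e (A : 'M[L]_(d, e)) B : mx_value A B -> mx_value (- A) (- B).
Proof. by move=> AB p q; rewrite !mxE; apply: ratfun_valueN. Qed.

Lemma mx_valueM d e h (A : 'M[L]_(d, e)) (A' : 'M[L]_(e, h)) B B' :
  mx_value A B -> mx_value A' B' -> mx_value (A *m A') (B *m B').
Proof.
move=> AB AB' p q; rewrite !mxE; apply: ratfun_value_sum => i _.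
exact: ratfun_valueM.
Qed.

Lemma ratfun_value_nat b : ratfun_value b%:R C b%:R.
Proof.
elim: b => [|b IHb]; first exact: ratfun_value0.
by rewrite !mulrS; apply: ratfun_valueD => //; exact: ratfun_value1.
Qed.

Lemma mx_value_scalar d f u : ratfun_value f C u -> mx_value (f%:M : 'M[L]_d) u%:M.
Proof.
move=> fu p q; rewrite !mxE; case: (p == q); rewrite ?mulr0n ?mulr1n //.
exact: ratfun_value0.
Qed.

Lemma mx_value_delta d e i j : mx_value (delta_mx i j : 'M[L]_(d, e)) (delta_mx i j).
Proof. by move=> p q; rewrite !mxE; apply: ratfun_value_nat. Qed.

Lemma ratfun_value_sign b : ratfun_value ((-1) ^+ b) C ((-1) ^+ b).
Proof.
elim: b => [|b IHb]; first by rewrite !expr0; apply: ratfun_value1.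
rewrite !exprS; apply: ratfun_valueM => //.
exact/ratfun_valueN/ratfun_value1.
Qed.

Lemma ratfun_value_det d (A : 'M[L]_d) B : mx_value A B -> ratfun_value (\det A) C (\det B).
Proof.
move=> AB; apply: ratfun_value_sum => s _; apply: ratfun_valueM; first exact: ratfun_value_sign.
exact: ratfun_value_prod.
Qed.

Lemma mx_valueV d (A : 'M[L]_d) B : mx_value A B -> \det B != 0 ->
  mx_value (invmx A) (invmx B).
Proof.
move=> AB dB; have dAB := ratfun_value_det AB.
have dA : \det A != 0.
  by apply: unit_germ_neq0; apply/asboolP; rewrite (unit_germ_value dAB).
rewrite /invmx !unitmxE !unitfE dA dB => p q; rewrite !mxE.
apply: ratfun_valueM; first exact: ratfun_valueV.
apply: ratfun_valueM.
  exact: ratfun_value_sign.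
by apply: ratfun_value_det => i j; rewrite !mxE.
Qed.

Lemma mx_value_vec d e (A : 'M[L]_(1, d * e)) B :
  mx_value A B -> mx_value (vec_mx A) (vec_mx B).
Proof. by move=> AB p q; rewrite !mxE. Qed.

Lemma mx_value_mxvec d e (A : 'M[L]_(d, e)) B :
  mx_value A B -> mx_value (mxvec A) (mxvec B).
Proof. by move=> AB p q; case/mxvec_indexP: q => i j; rewrite (ord1 p) !mxvecE. Qed.

Lemma mx_value_lin d1 e1 d2 e2 (h : 'M[L]_(d1, e1) -> 'M[L]_(d2, e2))
    (h' : 'M[K]_(d1, e1) -> 'M[K]_(d2, e2)) :
  (forall A B, mx_value A B -> mx_value (h A) (h' B)) ->
  mx_value (lin_mx h) (lin_mx h').
Proof.
move=> hh' p q; rewrite !mxE /=; apply: mx_value_mxvec; apply: hh'.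
exact/mx_value_vec/mx_value_delta.
Qed.

End LocalRing.

(** * The construction at the generic point *)

Section SiftValue.
Variables (K : fieldType) (n m : nat) (C : mtuple K n m).
Variable d : nat.
Local Notation L := (ratfun K n m).
Implicit Types (X Y : 'M[L]_d).
Implicit Types (s : seq 'M[L]_d).

Local Notation all_units fs := (all (fun f : L => `[< unit_germ C f >]) fs).
Local Notation all_neq0 us := (all (fun u : K => u != 0) us).

Fixpoint seq_value (s : seq 'M[L]_d) (s' : seq 'M[K]_d) : Prop :=
  match s, s' with
  | [::], [::] => True
  | X :: t, X' :: t' => mx_value C X X' /\ seq_value t t'
  | _, _ => False
  end.

Lemma sylvester_value X Y (X' Y' : 'M[K]_d) : mx_value C X X' -> mx_value C Y Y' ->
  mx_value C (sylvester X Y) (sylvester X' Y').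
Proof.
move=> vX vY; apply: mx_valueD; first by apply: mx_value_lin => A B vAB; apply: mx_valueM.
by apply/mx_valueN/mx_value_lin => A B vAB; apply: mx_valueM.
Qed.

Lemma sylvester_sol_value X Y (X' Y' : 'M[K]_d) : mx_value C X X' -> mx_value C Y Y' ->
  \det (sylvester X' Y') != 0 ->
  mx_value C (sylvester_sol X Y) (sylvester_sol X' Y').
Proof.
move=> vX vY dS; apply/mx_value_vec/mx_valueM.
  by apply/mx_value_mxvec/mx_value_scalar/ratfun_value1.
by apply: mx_valueV => //; apply: sylvester_value.
Qed.

Lemma swap_value X Y (X' Y' : 'M[K]_d) : mx_value C X X' -> mx_value C Y Y' ->
  all_units (swap_dets X Y) = all_neq0 (swap_dets X' Y') /\
  (all_neq0 (swap_dets X' Y') ->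
   mx_value C (swap X Y).1 (swap X' Y').1 /\ mx_value C (swap X Y).2 (swap X' Y').2).
Proof.
move=> vX vY; have vS := ratfun_value_det (sylvester_value vX vY).
rewrite /= !andbT (unit_germ_value vS).
have [|dS] := eqVneq (\det (sylvester X' Y')) 0; first by split.
have vT := sylvester_sol_value vX vY dS.
rewrite (unit_germ_value (ratfun_value_det vT)); split=> //= dT.
have vV := mx_valueV vT dT.
by split; rewrite /swap /=; apply: mx_valueD => //; apply: mx_valueN.
Qed.

Lemma carry_value X s (X' : 'M[K]_d) (s' : seq 'M[K]_d) : mx_value C X X' -> seq_value s s' ->
  all_units (carry_dets X s) = all_neq0 (carry_dets X' s') /\
  (all_neq0 (carry_dets X' s') ->
   seq_value (carry X s).1 (carry X' s').1 /\ mx_value C (carry X s).2 (carry X' s').2).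
Proof.
elim: s X s' X' => [|Y s IHs] X [|Y' s'] X' // vX [vY vs].
have [eqd vsw] := swap_value vX vY.
rewrite !carry_dets_cons !all_cat eqd; case: (boolP (all _ (swap_dets X' Y'))) => //= /vsw[v1 v2].
have [eqm vm] := IHs _ _ _ v2 vs.
by split=> // /vm[].
Qed.

(** Evaluation at [C] commutes with sifting.  The determinants met over the
    rational functions are units at [C] exactly when those met at [C] do not
    vanish: each of them is regular at [C] once the previous ones are units. *)
Lemma sift_value (b : seq bool) s (s' : seq 'M[K]_d) : seq_value s s' ->
  all_units (sift_dets (zip b s)) = all_neq0 (sift_dets (zip b s')) /\
  (all_neq0 (sift_dets (zip b s')) ->
   seq_value (sift (zip b s)).1 (sift (zip b s')).1 /\
   seq_value (sift (zip b s)).2 (sift (zip b s')).2).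
Proof.
elim: b s s' => [|c b IHb] [|X s] [|X' s'] // [vX vs].
have [eqd vd] := IHb _ _ vs.
rewrite /zip -/zip !sift_dets_cons !all_cat eqd.
case: (boolP (all _ (sift_dets (zip b s')))) => //= /vd[v1 v2].
case: c; last by split.
have [eqm vm] := carry_value vX v1.
by rewrite eqm; split=> //= /vm[].
Qed.

Lemma seq_value_sum s (s' : seq 'M[K]_d) : seq_value s s' ->
  mx_value C (\sum_(A <- s) A) (\sum_(A <- s') A).
Proof.
elim: s s' => [|X s IHs] [|X' s'] // => [_|[vX vs]].
  by rewrite !big_nil => p q; rewrite !mxE; apply: ratfun_value0.
by rewrite !big_cons; apply: mx_valueD => //; apply: IHs.
Qed.

End SiftValue.

Section GenericFamily.
Variables (K : fieldType) (m' n N : nat).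
Local Notation m := m'.+1.
Variables (A0 : 'M[K]_m) (uA0 : A0 \in unitmx).
Local Notation L := (ratfun K n m).

Definition generic_point (i : 'I_n) : 'M[L]_m :=
  \matrix_(p, q) tofrac ('X_(enum_rank (i, p, q)) : epoly K n m).

Definition generic_A0 : 'M[L]_m := \matrix_(p, q) tofrac ((A0 p q)%:MP_[_]).

Lemma generic_point_value (C : mtuple K n m) i : mx_value C (generic_point i) (C i).
Proof.
move=> p q; rewrite mxE.
have := ratfun_value_poly C ('X_(enum_rank (i, p, q)) : epoly K n m).
by rewrite /epoly_eval mevalXU enum_rankK.
Qed.

Lemma generic_A0_value (C : mtuple K n m) : mx_value C generic_A0 A0.
Proof. by move=> p q; rewrite mxE; apply: ratfun_value_const. Qed.

Lemma detA0 : \det A0 != 0. Proof. by rewrite -unitfE -unitmxE. Qed.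

Lemma conjshift_value (C : mtuple K n m) (g X : 'M[L]_m) g' X' (c : L) c' :
  \det g' != 0 -> mx_value C g g' -> mx_value C X X' -> ratfun_value c C c' ->
  mx_value C (conjshift g c X) (conjshift g' c' X').
Proof.
move=> dg vg vX vc; apply: mx_valueD; last exact: mx_value_scalar.
apply: mx_valueM => //; apply: mx_valueM => //; exact: mx_valueV.
Qed.

Lemma particle_mx_value (C : mtuple K n m) x :
  mx_value C (particle_mx N generic_A0 generic_point x) (particle_mx N A0 C x).
Proof.
rewrite /particle_mx; elim: x.1 => [|u IHu] /=; last first.
  apply: conjshift_value => //; [exact: detA0 | exact: generic_A0_value|].
  exact/ratfun_valueN/ratfun_value1.
elim: N => [|v IHv] /=; first exact: generic_point_value.
apply: conjshift_value => //; last exact: ratfun_value1.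
  by rewrite det_inv invr_eq0 detA0.
by apply: mx_valueV; [apply: generic_A0_value | apply: detA0].
Qed.

Local Notation parts := (particles n (2 * N)).

Lemma seq_value_particle_mx (C : mtuple K n m) (xs : seq (nat * 'I_n)) :
  seq_value C (map (particle_mx N generic_A0 generic_point) xs) (map (particle_mx N A0 C) xs).
Proof. by elim: xs => //= x xs IHxs; split=> //; apply: particle_mx_value. Qed.

Definition obstructions : seq L :=
  flatten [seq sift_dets (zip b (map (particle_mx N generic_A0 generic_point) parts))
          | b : (size parts).-tuple bool <- enum {: (size parts).-tuple bool}].

Lemma regular_configP (C : mtuple K n m) :
  regular_config N A0 C <->
  all (fun f : L => `[< unit_germ C f >]) obstructions.
Proof.
split=> [reg|/allP reg b].
  apply/allP => f /flatten_mapP[b _]; move: f; apply/allP.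
  by have [-> _] := sift_value b (seq_value_particle_mx C parts); apply: reg.
have [<- _] := sift_value b (seq_value_particle_mx C parts).
by apply/allP => f fb; apply: reg; apply/flatten_mapP; exists b; rewrite ?mem_enum.
Qed.

(** Being a unit at a point persists where the numerators and denominators that
    show it do not vanish. *)
Lemma unit_germ_open (C0 : mtuple K n m) (fs : seq L) :
  all (fun f : L => `[< unit_germ C0 f >]) fs ->
  exists2 P : epoly K n m, epoly_eval P C0 != 0 &
    forall C : mtuple K n m, epoly_eval P C != 0 ->
    all (fun f : L => `[< unit_germ C f >]) fs.
Proof.
elim: fs => [_|f fs IHfs /= /andP[/asboolP[P [Q [eqf P0 Q0]]] /IHfs[R R0 openR]]].
  by exists 1 => //; rewrite /epoly_eval meval1 oner_neq0.
exists (P * Q * R) => [|C]; first by rewrite !epoly_evalM !mulf_neq0.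
rewrite !epoly_evalM !mulf_eq0 !negb_or => /andP[/andP[PC QC] /openR ->].
by rewrite andbT; apply/asboolP; exists P, Q.
Qed.

Lemma regular_config_open (C0 : mtuple K n m) : regular_config N A0 C0 ->
  exists2 P : epoly K n m, epoly_eval P C0 != 0 &
    forall C : mtuple K n m, epoly_eval P C != 0 -> regular_config N A0 C.
Proof.
move=> /regular_configP/unit_germ_open[P P0 openP]; exists P => // C PC.
by apply/regular_configP/openP.
Qed.

Lemma evolution_value (C : mtuple K n m) i l : regular_config N A0 C ->
  mx_value C (evolution N generic_A0 generic_point i l) (evolution N A0 C i l).
Proof.
move=> reg; have vz k : mx_value C (rsum N generic_A0 generic_point k) (rsum N A0 C k).
  apply: seq_value_sum; rewrite /right_factors /labelled -!zip_map.
  have [_ vs] := sift_value (map (right_of N k) parts) (seq_value_particle_mx C parts).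
  by apply: (vs _).2; apply: reg (map_tuple (right_of N k) (in_tuple parts)).
by apply: mx_valueD => //; apply: mx_valueN.
Qed.

End GenericFamily.

(** * Exchanges of triangular matrices never fail *)

Section LowerTriangular.
Variables (K : fieldType) (m : nat).
Implicit Types (X Y S T W : 'M[K]_m) (x y : 'I_m -> K).

Definition trig_with x X : Prop :=
  (forall p q : 'I_m, (p < q)%N -> X p q = 0) /\ forall p, X p p = x p.

Lemma trig_withM x y X Y : trig_with x X -> trig_with y Y ->
  trig_with (fun p => x p * y p) (X *m Y).
Proof.
move=> [X0 Xd] [Y0 Yd]; split=> [p q ltpq|p]; rewrite !mxE.
  rewrite big1 // => r _; case: (ltnP p r) => [/X0->|lerp]; first by rewrite mul0r.
  by rewrite Y0 ?mulr0 //; apply: leq_ltn_trans ltpq.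
rewrite (bigD1 p) //= Xd Yd big1 ?addr0 // => r neqrp.
case: (ltngtP p r) neqrp => [/X0->|/Y0->|/val_inj->]; rewrite ?mul0r ?mulr0 ?eqxx //.
Qed.

Lemma trig_withD x y X Y : trig_with x X -> trig_with y Y ->
  trig_with (fun p => x p + y p) (X + Y).
Proof.
move=> [X0 Xd] [Y0 Yd]; split=> [p q ltpq|p]; rewrite !mxE ?Xd ?Yd //.
by rewrite X0 ?Y0 ?addr0.
Qed.

Lemma trig_withN x X : trig_with x X -> trig_with (fun p => - x p) (- X).
Proof.
by move=> [X0 Xd]; split=> [p q ltpq|p]; rewrite !mxE ?Xd // X0 ?oppr0.
Qed.

Lemma trig_with_scalar c : trig_with (fun=> c) c%:M.
Proof.
by split=> [p q|p]; rewrite !mxE ?eqxx // -val_eqE; case: ltngtP.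
Qed.

Lemma eq_trig_with x y X : x =1 y -> trig_with x X -> trig_with y X.
Proof. by move=> eqxy [X0 Xd]; split=> // p; rewrite Xd. Qed.

(** The entry [(p, q)] of [T X - Y T] is [T p q * (x q - y p)] plus terms in
    entries of [T] closer to the upper right corner.  So [T] vanishes on the
    region [p < q + b] as soon as [T X - Y T] does: [b = 0] gives triangularity,
    and [b = m] injectivity of the Sylvester map. *)
Lemma sylvester_band (b : nat) x y X Y T : trig_with x X -> trig_with y Y ->
  (forall p q, x q != y p) ->
  (forall p q : 'I_m, (p < q + b)%N -> (T *m X - Y *m T) p q = 0) ->
  forall p q : 'I_m, (p < q + b)%N -> T p q = 0.
Proof.
move=> [X0 Xd] [Y0 Yd] neq W0 p q; have [d] := ubnP (m + p - q)%N.
elim: d p q => // d IHd p q ltd ltpq.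
have := W0 p q ltpq; rewrite !mxE (bigD1 q) //= big1 => [|r neqrq]; last first.
  case: (ltngtP r q) neqrq => [/X0->|ltqr|/val_inj->]; rewrite ?mulr0 ?eqxx //.
  by rewrite IHd ?mul0r //; have := ltn_ord r; lia.
rewrite (bigD1 p) //= big1 => [|r neqrp]; last first.
  case: (ltngtP p r) neqrp => [/Y0->|ltrp|/val_inj->]; rewrite ?mul0r ?eqxx //.
  by rewrite IHd ?mulr0 //; have := ltn_ord q; lia.
rewrite !addr0 Xd Yd mulrC -mulrBl => /eqP; rewrite mulf_eq0 subr_eq0.
by rewrite (negbTE (neq _ _)) => /eqP.
Qed.

Lemma trig_with_inv x X : X \in unitmx -> trig_with x X -> (forall p, x p != 0) ->
  trig_with (fun p => (x p)^-1) (invmx X).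
Proof.
move=> uX tX x0.
have tV (p q : 'I_m) : (p < q)%N -> invmx X p q = 0.
  rewrite -[X in (_ < X)%N]addn0.
  (* [S T - 0 S = 1]: inversion is the Sylvester equation with [Y = 0]. *)
  apply: (sylvester_band tX (trig_with_scalar 0)) => [p' q'|p' q' ltpq]; first exact: x0.
  rewrite mulVmx // mul_scalar_mx scale0r subr0 !mxE -val_eqE.
  by rewrite addn0 in ltpq; case: ltngtP ltpq.
split=> // p; have [_ /(_ p)] := trig_withM (conj tV (frefl _)) tX.
rewrite mulVmx // !mxE eqxx => e1; apply: (mulIf (x0 p)).
by rewrite mulVf.
Qed.

Lemma trig_with_unit x X : trig_with x X -> (X \in unitmx) = [forall p, x p != 0].
Proof.
move=> [X0 Xd]; rewrite unitmxE unitfE det_trig; last exact/is_trig_mxP.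
by apply/prodf_neq0/forallP => X_neq0 p; have := X_neq0 p; rewrite Xd // => ->.
Qed.

End LowerTriangular.

Section Triangularized.
Variables (K : fieldType) (m : nat) (P : 'M[K]_m).
Hypothesis uP : P \in unitmx.
Implicit Types (X Y S T W : 'M[K]_m) (x y : 'I_m -> K).

Local Notation cj X := (P *m X *m invmx P).

Definition trig_in x X : Prop := trig_with x (cj X).

Lemma cjM X Y : cj (X *m Y) = cj X *m cj Y.
Proof. by rewrite !mulmxA mulmxKV. Qed.

Lemma cjD X Y : cj (X + Y) = cj X + cj Y.
Proof. by rewrite mulmxDr mulmxDl. Qed.

Lemma cjN X : cj (- X) = - cj X.
Proof. by rewrite mulmxN mulNmx. Qed.

Lemma cj_scalar c : cj c%:M = c%:M.
Proof. by rewrite mul_mx_scalar -scalemxAl mulmxV // scalemx1. Qed.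

Lemma cj_inj : injective (fun X => cj X).
Proof.
move=> X Y /(congr1 (fun Z => invmx P *m Z *m P)) /=.
by rewrite !mulmxA mulVmx // !mul1mx -!mulmxA mulVmx // !mulmx1.
Qed.

Lemma cj_unit X : (cj X \in unitmx) = (X \in unitmx).
Proof. by rewrite !unitmx_mul unitmx_inv uP /= andbT. Qed.

Lemma cjV X : X \in unitmx -> cj (invmx X) = invmx (cj X).
Proof.
move=> uX; have uc : cj X \in unitmx by rewrite cj_unit.
rewrite -[LHS]mul1mx -(mulVmx uc) -(mulmxA (invmx (cj X))).
by rewrite -cjM mulmxV // cj_scalar mulmx1.
Qed.

Lemma trig_in_unit x X : trig_in x X -> (forall p, x p != 0) -> X \in unitmx.
Proof.
by move=> tX x0; rewrite -cj_unit (trig_with_unit tX); apply/forallP.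
Qed.

Lemma trig_in_inv x X : trig_in x X -> (forall p, x p != 0) ->
  trig_in (fun p => (x p)^-1) (invmx X).
Proof.
move=> tX x0; have uX := trig_in_unit tX x0.
by rewrite /trig_in cjV //; apply: trig_with_inv; rewrite ?cj_unit.
Qed.

(** The solution [T] of the Sylvester equation is triangular with diagonal
    entries [1 / (x_p - y_p)], so it is invertible, and the diagonals of [X - S]
    and [Y + S] are [x - (x - y)] and [y + (x - y)]. *)
Lemma trig_in_swap x y X Y : trig_in x X -> trig_in y Y -> (forall p q, x q != y p) ->
  [/\ all (fun d => d != 0) (swap_dets X Y), trig_in y (swap X Y).1
    & trig_in x (swap X Y).2].
Proof.
move=> tX tY neq.
have dS : \det (sylvester X Y) != 0.
  apply/negP=> /det0P[v v0]; rewrite -[v]vec_mxK sylvesterE => /eqP.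
  rewrite mxvec_eq0 => /eqP eqT; case/negP: v0; set T := vec_mx v in eqT.
  have eqcj : cj T *m cj X - cj Y *m cj T = 0.
    by rewrite -!cjM -cjN -cjD eqT mulmx0 mul0mx.
  have cT0 : cj T = 0.
    apply/matrixP=> p q; rewrite [RHS]mxE.
    apply: (sylvester_band (b := m) tX tY neq) => [p' q' _|].
      by rewrite eqcj mxE.
    by apply: ltn_addl.
  have T0 : T = 0 by apply: cj_inj; rewrite cT0 mulmx0 mul0mx.
  by rewrite -[v]vec_mxK -/T T0 linear0.
have eqT := sylvester_solP dS; rewrite /swap /swap_dets /= dS andbT /=.
move: eqT; set T := sylvester_sol X Y => eqT.
have eqcj : cj T *m cj X - cj Y *m cj T = 1%:M.
  by rewrite -!cjM -cjN -cjD eqT cj_scalar.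
have T0 (p q : 'I_m) : (p < q)%N -> cj T p q = 0.
  rewrite -[X in (_ < X)%N]addn0.
  apply: (sylvester_band tX tY neq) => p' q'; rewrite addn0 => ltpq.
  by rewrite eqcj mxE -val_eqE; case: ltngtP ltpq.
have tT : trig_in (fun p => (x p - y p)^-1) T.
  split=> // p; have xy0 : x p - y p != 0 by rewrite subr_eq0.
  have tT0 := conj T0 (frefl (fun p => cj T p p)).
  have [_ /(_ p)] := trig_withD (trig_withM tT0 tX) (trig_withN (trig_withM tY tT0)).
  rewrite eqcj mxE eqxx => e1; apply: (mulIf xy0).
  by rewrite mulVf // mulrBr [X in _ - X]mulrC; apply: esym.
have xy0 p : (x p - y p)^-1 != 0 by rewrite invr_eq0 subr_eq0.
have tV := trig_in_inv tT xy0.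
split; first by rewrite -unitfE -unitmxE (trig_in_unit tT).
- rewrite /trig_in cjD cjN; apply: eq_trig_with (trig_withD tX (trig_withN tV)) => p.
  by rewrite invrK opprB addrC subrK.
- rewrite /trig_in cjD; apply: eq_trig_with (trig_withD tY tV) => p.
  by rewrite invrK addrC subrK.
Qed.

Section Sift.
Variables (I : eqType) (f : I -> 'I_m -> K).

Fixpoint trig_in_seq (xs : seq I) (s : seq 'M[K]_m) : Prop :=
  match xs, s with
  | [::], [::] => True
  | i :: xs', X :: s' => trig_in (f i) X /\ trig_in_seq xs' s'
  | _, _ => False
  end.

Lemma trig_in_carry i (xs : seq I) X s : trig_in (f i) X -> trig_in_seq xs s ->
  (forall j, j \in xs -> forall p q, f i q != f j p) ->
  [/\ all (fun d => d != 0) (carry_dets X s), trig_in_seq xs (carry X s).1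
    & trig_in (f i) (carry X s).2].
Proof.
elim: xs s X => [|j xs IHxs] [|Y s] X // tX [tY ts] neq.
have [dets t1 t2] := trig_in_swap tX tY (neq j (mem_head _ _)).
have [|dets' t1' t2'] := IHxs s _ t2 ts.
  by move=> k kxs; apply: neq; rewrite inE kxs orbT.
by rewrite carry_dets_cons all_cat dets.
Qed.

Lemma trig_in_sift (b : seq bool) (xs : seq I) s : trig_in_seq xs s -> uniq xs ->
  (forall i j, i != j -> forall p q, f i q != f j p) ->
  all (fun d => d != 0) (sift_dets (zip b s)) /\
  exists2 ys : seq I, {subset ys <= xs} & trig_in_seq ys (sift (zip b s)).1.
Proof.
move=> + + neq; elim: b xs s => [|c b IHb] [|i xs] [|X s] //.
- by move=> _ _; split=> //; exists [::].
- by move=> _ _; split=> //; exists [::].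
- by move=> _ _; split=> //; exists [::].
move=> [tX ts]; rewrite cons_uniq => /andP[ixs uxs]; have [dets [ys sub tys]] := IHb _ _ ts uxs.
rewrite /zip -/zip sift_dets_cons all_cat dets; case: c => /=; last first.
  split=> //; exists (i :: ys) => // k; rewrite !inE => /orP[->//|/sub->].
  by rewrite orbT.
have [|dets' t1 _] := trig_in_carry tX tys.
  by move=> j /sub jxs; apply: neq; apply: contraNneq ixs => ->.
split=> //; exists ys => // k /sub kxs; by rewrite inE kxs orbT.
Qed.

End Sift.
End Triangularized.

(** * A regular point, and the theorem *)

Section RegularPoint.
Variables (K : numClosedFieldType) (m' n N : nat).
Local Notation m := m'.+1.
Variables (A0 : 'M[K]_m) (uA0 : A0 \in unitmx).
Variables (a : 'I_n -> 'I_m -> K) (aZ : no_integer_difference a).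

Lemma trig_in_conjshift (P g X : 'M[K]_m) al x c : P \in unitmx ->
  trig_in P al g -> (forall p, al p != 0) -> trig_in P x X ->
  trig_in P (fun p => x p + c) (conjshift g c X).
Proof.
move=> uP tg al0 tX; rewrite /trig_in /conjshift cjD cj_scalar // !cjM //.
apply: trig_withD; last exact: trig_with_scalar.
apply: eq_trig_with (trig_withM (trig_withM (trig_in_inv uP tg al0) tX) tg) => p.
by rewrite mulrAC mulVf ?mul1r.
Qed.

(** In a basis where [A0] is triangular, take the [C_i] diagonal; all particles
    are then triangular, with pairwise disjoint diagonals. *)
Lemma regular_point : exists2 C : 'I_n -> 'M[K]_m,
  prescribed a C & regular_config N A0 C.
Proof.
have [P /unitarymx_unit uP] := Schur A0 (ltn0Sn m').
rewrite /similar_to /= conjumx // => /is_trig_mxP trA0.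
pose al p := (P *m A0 *m invmx P) p p.
have tA0 : trig_in P al A0 by split.
have al0 p : al p != 0.
  have: P *m A0 *m invmx P \in unitmx by rewrite cj_unit.
  by rewrite (trig_with_unit tA0) => /forallP.
have tV := trig_in_inv uP tA0 al0.
have alV0 p : (al p)^-1 != 0 by rewrite invr_eq0.
pose C i := invmx P *m diag_mx (\row_p a i p) *m P.
have tC i : trig_in P (a i) (C i).
  have cjC : P *m C i *m invmx P = diag_mx (\row_p a i p).
    by rewrite /C !mulmxA mulmxV // mul1mx -mulmxA mulmxV // mulmx1.
  rewrite /trig_in cjC; split=> [p q ltpq|p]; rewrite !mxE ?eqxx //.
  by rewrite -val_eqE; case: ltngtP ltpq.
exists C => [i|b].
  apply: Sp_roots; rewrite /C char_poly_conj ?mulmxV //.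
  rewrite char_poly_trig; last exact: diag_mx_is_trig.
  by apply: eq_bigr => p _; rewrite !mxE eqxx.
have tpm x : trig_in P (particle_zero N a x) (particle_mx N A0 C x).
  rewrite /particle_mx /particle_zero; case: x => u i /=.
  have tN : trig_in P (fun p => a i p + N%:R) (iter N (prev_period A0) (C i)).
    elim: (N) => [|v IHv] /=.
      by apply: eq_trig_with (tC i) => p; rewrite addr0.
    apply: eq_trig_with (trig_in_conjshift 1 uP tV alV0 IHv) => p.
    by rewrite -addrA natr1.
  elim: u => [|u IHu] /=.
    by apply: eq_trig_with tN => p; rewrite subr0.
  apply: eq_trig_with (trig_in_conjshift (-1) uP tA0 al0 IHu) => p.
  by rewrite -natr1 opprD !addrA.
have ts (xs : seq (nat * 'I_n)) :
    trig_in_seq P (particle_zero N a) xs (map (particle_mx N A0 C) xs).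
  by elim: xs.
have neq x y (neqxy : x != y) p q := particle_zero_neq N aZ neqxy q p.
by have [] := trig_in_sift uP b (ts _) (uniq_particles n (2 * N)) neq.
Qed.

End RegularPoint.

Local Open Scope classical_set_scope.

Theorem theorem4p5 (R : realType) (m n M : nat) (A0 : 'M[R[i]]_m) :
  (0 < m)%N -> (0 < n)%N -> (0 < M)%N -> A0 \in unitmx ->
  exists F : 'I_n -> 'rV[int]_n -> 'I_m -> 'I_m -> ratfun R[i] n m,
  forall a : 'I_n -> 'I_m -> R[i], no_integer_difference a ->
  generic (prescribed a) [set C |
    exists D : mfamily R[i] n m,
      [/\ is_solution M A0 C D,
          forall D' : mfamily R[i] n m, is_solution M A0 C D' ->
            forall (i : 'I_n) (l : 'rV[int]_n), in_box M l -> D' i l = D i l,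
          quasiperiodic M A0 D,
          forall (i : 'I_n) (l : 'rV[int]_n) (p q : 'I_m), in_box M l ->
            ratfun_value (F i l p q) C (D i l p q)
        & difference_schlesinger M A0 D]].
Proof.
case: m A0 => // m' A0 _ _ _ uA0; pose N := (M + 3)%N.
exists (fun i l p q => evolution N (generic_A0 n A0) (@generic_point R[i] m' n) i l p q).
move=> a aZ.
pose S := [set P : epoly R[i] n m'.+1 |
  forall C : mtuple R[i] n m'.+1, epoly_eval P C != 0 -> regular_config N A0 C].
(* The open set is the complement of the common zeros of the polynomials whose
   non-vanishing forces regularity. *)
exists (prescribed a `&` [set C | exists2 P, S P & epoly_eval P C != 0]); split.
- by exists S.
- have [C0 spC0 /(regular_config_open uA0)[P P0 SP]] := regular_point N uA0 aZ.
  by exists C0; split=> //; exists P.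
move=> C [spC [P SP PC]] /=; have reg := SP C PC.
have charC := char_poly_prescribed aZ spC.
exists (evolution N A0 C); split.
- exact: (evolution_solution uA0 aZ).
- move=> D' solD'; apply: (solution_unique uA0 aZ spC) => //.
  exact: (evolution_solution uA0 aZ).
- exact: (evolution_quasiperiodic uA0 aZ).
- by move=> i l p q _; apply: evolution_value.
- exact: (evolution_schlesinger uA0 aZ).
Qed.
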